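(* Assume that $f$ is the generator of a continuous one-parameter semigroup of holomorphic self-mappings of the open unit disk $\mathbb{D}$ with the Denjoy-Wolff point $a=0$. If $\zeta_1,\dots,\zeta_N\in\partial\mathbb{D}$ are pairwise distinct boundary regular null points of $f$, then for all $z\in\mathbb{D}$ (the expression being extended to $z=0$ through its removable singularity) one has $$C\,\frac{1-|z|}{1+|z|}\le\Big|z\Big(\frac1{f(z)}-\sum_{n=1}^N\frac1{|f'(\zeta_n)|}\Big(\frac1{2z}-\frac1{z-\zeta_n}\Big)\Big)-i\operatorname{Im}\frac1{f'(0)}\Big|\le C\,\frac{1+|z|}{1-|z|},$$ where $$C=\operatorname{Re}\frac1{f'(0)}-\frac12\sum_{n=1}^N\frac1{|f'(\zeta_n)|}.$$
   Context: $\mathbb{D}$ is the open unit disk in $\mathbb{C}$. A (continuous one-parameter) semigroup on $\mathbb{D}$ is a family $\{F_t\}_{t\ge0}$ of holomorphic self-mappings of $\mathbb{D}$ with $F_{s+t}=F_s\circ F_t$, $F_0(z)=z$, continuous in $t$. Its (infinitesimal) generator is the holomorphic function $f(z)=\lim_{t\to0^+}\frac1t(z-F_t(z))$ on $\mathbb{D}$. For a semigroup that is nontrivial and contains no elliptic automorphisms of $\mathbb{D}$, the Denjoy-Wolff point is the unique $a\in\overline{\mathbb{D}}$ with $F_t(z)\to a$ as $t\to\infty$ for all $z\in\mathbb{D}$. For $\zeta\in\partial\mathbb{D}$, $f(\zeta)$ denotes the angular (nontangential) limit of $f$ at $\zeta$, and, when this is $0$, $f'(\zeta)=\angle\lim_{z\to\zeta}\frac{f(z)}{z-\zeta}$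 is the angular derivative. A boundary regular null point of $f$ is a point $\zeta\in\partial\mathbb{D}$ at which the angular limit of $f$ exists and equals $0$ and the angular derivative exists and is finite; at such points (different from the Denjoy-Wolff point) the angular derivative is a negative real number. *)

(* Defs.v *)
From Stdlib Require Import Reals Lra.
From Coquelicot Require Import Coquelicot.

Open Scope R_scope.

Definition in_disk (z : C) : Prop := Cmod z < 1.

(* Functions on the disk are total functions [C -> C] whose values outside the
   disk are never used; [ex_derive] over [C_AbsRing] is complex
   differentiability. *)
Definition holomorphic_on_disk (f : C -> C) : Prop :=
  forall z : C, in_disk z -> ex_derive (K := C_AbsRing) (V := C_NormedModule) f z.

Record is_semigroup (F : R -> C -> C) : Prop := {
  semigroup_holomorphic : forall t, 0 <= t -> holomorphic_on_disk (F t);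
  semigroup_self_map : forall t z, 0 <= t -> in_disk z -> in_disk (F t z);
  semigroup_add : forall s t z, 0 <= s -> 0 <= t -> in_disk z ->
    F (s + t) z = F s (F t z);
  semigroup_0 : forall z, in_disk z -> F 0 z = z;
  semigroup_continuous : forall z t0, in_disk z -> 0 <= t0 ->
    filterlim (fun t => F t z) (within (fun t => 0 <= t) (locally t0))
      (locally (F t0 z))
}.

Definition is_generator (F : R -> C -> C) (f : C -> C) : Prop :=
  holomorphic_on_disk f /\
  forall z, in_disk z ->
    filterlim (fun t : R => ((z - F t z) / RtoC t)%C) (at_right 0) (locally (f z)).

(* No separate assumption that the semigroup is nontrivial and contains no
   elliptic automorphism is needed: it follows from the convergence of all the
   orbits to a single point. *)
Definition is_denjoy_wolff_point (F : R -> C -> C) (a : C) : Prop :=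
  Cmod a <= 1 /\
  forall z, in_disk z ->
    filterlim (fun t => F t z) (Rbar_locally p_infty) (locally a).

Definition stolz_region (zeta : C) (k : R) (z : C) : Prop :=
  in_disk z /\ Cmod (z - zeta) < k * (1 - Cmod z).

(* A function tends to [l] along this filter iff it tends to [l] as
   [z -> zeta] inside every Stolz region of vertex [zeta]. *)
Definition angular (zeta : C) : (C -> Prop) -> Prop :=
  fun P => forall k, 1 < k -> within (stolz_region zeta k) (locally zeta) P.

Global Instance angular_filter (zeta : C) : Filter (angular zeta).
Proof.
constructor.
- intros k _. apply filter_true.
- intros P Q HP HQ k Hk. apply filter_and; auto.
- intros P Q HPQ HP k Hk. apply filter_imp with (2 := HP k Hk). auto.
Qed.

Lemma angular_proper (zeta : C) :
  Cmod zeta = 1 -> ProperFilter (angular zeta).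
Proof.
intros Hz. constructor; [ | apply angular_filter ].
intros P HP.
assert (H2 : 1 < 2) by lra.
destruct (HP 2 H2) as [e He].
set (s := Rmin (e / 2) (1 / 2)).
assert (Hs : 0 < s) by (apply Rmin_pos; [ generalize (cond_pos e) | ]; lra).
assert (Hse : s < e).
{ generalize (Rmin_l (e / 2) (1 / 2)) (cond_pos e); fold s; lra. }
assert (Hs1 : s <= 1 / 2) by apply Rmin_r.
assert (Hm : Cmod (RtoC (1 - s) * zeta)%C = 1 - s).
{ rewrite Cmod_mult, Hz, Cmod_R, Rabs_pos_eq; lra. }
assert (Hd : Cmod ((RtoC (1 - s) * zeta)%C - zeta) = s).
{ replace ((RtoC (1 - s) * zeta)%C - zeta)%C with (RtoC (- s) * zeta)%C.
  - rewrite Cmod_mult, Hz, Cmod_R, Rabs_left; lra.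
  - rewrite RtoC_minus, RtoC_opp. ring. }
exists (RtoC (1 - s) * zeta)%C. apply He.
- apply C_NormedModule_mixin_compat1.
  change (Cmod ((RtoC (1 - s) * zeta)%C - zeta) < e). rewrite Hd. exact Hse.
- split; [ unfold in_disk | ]; rewrite ?Hd, Hm; lra.
Qed.

Definition is_angular_lim (f : C -> C) (zeta l : C) : Prop :=
  filterlim f (angular zeta) (locally l).

(* Only used at points where the angular limit of [f] is 0. *)
Definition is_angular_derivative (f : C -> C) (zeta l : C) : Prop :=
  is_angular_lim (fun z => (f z / (z - zeta))%C) zeta l.

Definition boundary_regular_null_point (f : C -> C) (zeta : C) : Prop :=
  Cmod zeta = 1 /\ is_angular_lim f zeta 0 /\
  exists l : C, is_angular_derivative f zeta l.

(* [h] is the function [g], holomorphic on the punctured disk, extended to the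
   whole disk through its removable singularity at 0. *)
Definition is_extension_at_0 (g h : C -> C) : Prop :=
  holomorphic_on_disk h /\
  forall z, in_disk z -> z <> RtoC 0 -> h z = g z.

(* Main.v *)
Require Import Defs.
From Stdlib Require Import Reals Lra Lia ClassicalEpsilon.
From Coquelicot Require Import Coquelicot.
Open Scope R_scope.

(* By the Schwarz lemma [f z = z * p z] with [Re p >= 0], and [q = 1/p] is
   holomorphic with [Re q >= 0].  At [zeta_n] it has a pole in the sense that
   [(1 - r) * q (r * zeta_n) -> 1/|f'(zeta_n)|], so Julia's lemma (the boundary
   limit of the Schwarz-Pick inequality) shows that subtracting
   [(zeta_n + z) / (zeta_n - z) / (2 |f'(zeta_n)|)], whose real part is a multiple
   of the Poisson kernel, leaves the real part nonnegative; the difference has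
   the same behaviour at the other [zeta_m], so all the poles can be subtracted.
   What remains is the function of the theorem, and the two bounds are the
   Schwarz-Pick inequality between [z] and 0.

   The Schwarz-Pick inequality follows from Cauchy's formula on circles, applied
   to [Re q |1/(zeta - a) + lam/(zeta - b)|^2 >= 0].  Cauchy's formula follows from
   the fact that the mean of a holomorphic function over the circle of radius
   [r] does not depend on [r], which is Goursat's lemma in polar coordinates. *)

(** * Goursat's lemma *)

(** The Schwarz-Pick inequality is kept free of quotients, so that it remains meaningful when [Re q]
    vanishes, and it does the work of the maximum principle: through a Cayley transform it gives
    Schwarz's lemma, and it shows that a single zero of [p] would force [p = 0], hence constant
    orbits, which cannot all tend to 0. This is why [q = 1/p] is defined on the whole disk. The sign
    of [f'(zeta_n)] comes out of the same inequality: the residue of [q] is [-1/f'(zeta_n)], and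
    Julia's inequality evaluated on the radius ending at [zeta_n] forces it to be positive. The
    bracket of the theorem multiplied by [z] is half the kernel [(zeta_n + z)/(zeta_n - z)], which
    equals 1 at [z = 0]. So the remaining function is holomorphic at 0 with value [1/f'(0)] minus
    half the sum: [C] is its real part there, and [Im (1/f'(0))] its imaginary part. *)

Lemma nested_intervals (a b : nat -> R) :
  (forall n, a n <= a (S n)) -> (forall n, b (S n) <= b n) -> (forall n, a n <= b n) ->
  exists x, forall n, a n <= x <= b n.
Proof.
intros Ha Hb Hab.
assert (Ha' : forall n k, a n <= a (n + k)%nat).
{ intros n k; induction k; [rewrite Nat.add_0_r; lra|].
  rewrite Nat.add_succ_r; eapply Rle_trans; [exact IHk|apply Ha]. }
assert (Hb' : forall n k, b (n + k)%nat <= b n).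
{ intros n k; induction k; [rewrite Nat.add_0_r; lra|].
  rewrite Nat.add_succ_r; eapply Rle_trans; [apply Hb|exact IHk]. }
assert (Hc : forall n m, a n <= b m).
{ intros n m. apply Rle_trans with (a (n + m)%nat); [apply Ha'|].
  apply Rle_trans with (b (n + m)%nat); [apply Hab|]. rewrite Nat.add_comm; apply Hb'. }
destruct (completeness (fun x => exists n, x = a n)) as [x [Hx1 Hx2]].
- exists (b O). intros y [n ->]; apply Hc.
- exists (a O), O; reflexivity.
- exists x; intros n; split.
  + apply Hx1; exists n; reflexivity.
  + apply Hx2; intros y [m ->]; apply Hc.
Qed.

(** If [P] failed, it would fail on one of the four quarters, and so on; the failing rectangles
    shrink to a point, where the local hypothesis contradicts the failure. *)
Lemma rectangle_bisection (P : R -> R -> R -> R -> Prop) (a b c d : R) :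
  a <= b -> c <= d ->
  (forall a b c d, a <= b -> c <= d ->
     P a ((a + b) / 2) c ((c + d) / 2) -> P ((a + b) / 2) b c ((c + d) / 2) ->
     P a ((a + b) / 2) ((c + d) / 2) d -> P ((a + b) / 2) b ((c + d) / 2) d ->
     P a b c d) ->
  (forall x y, a <= x <= b -> c <= y <= d ->
     exists e, 0 < e /\ forall a' b' c' d',
       a <= a' <= x -> x <= b' <= b -> c <= c' <= y -> y <= d' <= d ->
       b' - a' < e -> d' - c' < e -> P a' b' c' d') ->
  P a b c d.
Proof.
intros Hab Hcd Hsplit Hloc.
apply NNPP; intros HnP.
pose (lo := fun (s : bool) (u v : R) => if s then u else (u + v) / 2).
pose (hi := fun (s : bool) (u v : R) => if s then (u + v) / 2 else v).
(* The side conditions stand under the existential, so that the choice of a failing quarter becomes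
   a total function of the rectangle that can be iterated. *)
assert (Hstep : forall r : R * R * R * R, exists st : bool * bool,
  let '(a, b, c, d) := r in a <= b -> c <= d -> ~ P a b c d ->
  ~ P (lo (fst st) a b) (hi (fst st) a b) (lo (snd st) c d) (hi (snd st) c d)).
{ intros [[[a1 b1] c1] d1].
  apply NNPP; intros Hn.
  pose proof (not_ex_all_not _ _ Hn) as Hn'; clear Hn; simpl in Hn'.
  destruct (classic (a1 <= b1 /\ c1 <= d1 /\ ~ P a1 b1 c1 d1)) as [(H1 & H2 & H3)|H].
  - apply H3. apply Hsplit; auto; apply NNPP; intros H4.
    + apply (Hn' (true, true)); auto.
    + apply (Hn' (false, true)); auto.
    + apply (Hn' (true, false)); auto.
    + apply (Hn' (false, false)); auto.
  - apply (Hn' (true, true)). tauto. }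
pose (choice := fun r => proj1_sig (constructive_indefinite_description _ (Hstep r))).
pose (next := fun r : R * R * R * R => let '(a, b, c, d) := r in
  let st := choice r in
  (lo (fst st) a b, hi (fst st) a b, lo (snd st) c d, hi (snd st) c d)).
pose (s := fun n => Nat.iter n next (a, b, c, d)).
pose (A := fun n => fst (fst (fst (s n)))). pose (B := fun n => snd (fst (fst (s n)))).
pose (U := fun n => snd (fst (s n))). pose (V := fun n => snd (s n)).
assert (HS : forall n,
  A (S n) = lo (fst (choice (s n))) (A n) (B n) /\
  B (S n) = hi (fst (choice (s n))) (A n) (B n) /\
  U (S n) = lo (snd (choice (s n))) (U n) (V n) /\
  V (S n) = hi (snd (choice (s n))) (U n) (V n)).
{ intros n. unfold A, B, U, V. change (s (S n)) with (next (s n)).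
  destruct (s n) as [[[a1 b1] c1] d1]; simpl; auto. }
assert (Hlh : forall s u v, u <= v -> u <= lo s u v /\ hi s u v <= v /\
  hi s u v - lo s u v = (v - u) / 2).
{ intros [|] u v H; unfold lo, hi; lra. }
assert (Hinv : forall n, A n <= B n /\ U n <= V n /\ ~ P (A n) (B n) (U n) (V n)).
{ induction n as [|n (H1 & H2 & H3)].
  - repeat split; auto.
  - destruct (HS n) as (-> & -> & -> & ->).
    destruct (Hlh (fst (choice (s n))) _ _ H1) as (? & ? & ?).
    destruct (Hlh (snd (choice (s n))) _ _ H2) as (? & ? & ?).
    repeat split; [lra|lra|].
    generalize (proj2_sig (constructive_indefinite_description _ (Hstep (s n)))).
    fold (choice (s n)). unfold A, B, U, V in *.
    destruct (s n) as [[[a1 b1] c1] d1]; simpl in *; auto. }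
assert (Hw : forall n, B n - A n = (b - a) * (/ 2) ^ n /\ V n - U n = (d - c) * (/ 2) ^ n).
{ induction n as [|n [IH1 IH2]]; [unfold A, B, U, V; simpl; lra|].
  destruct (Hinv n) as (H1 & H2 & _), (HS n) as (-> & -> & -> & ->).
  destruct (Hlh (fst (choice (s n))) _ _ H1) as (_ & _ & ->).
  destruct (Hlh (snd (choice (s n))) _ _ H2) as (_ & _ & ->).
  rewrite IH1, IH2; simpl; lra. }
destruct (nested_intervals A B) as [x Hx]; try (intros n; apply Hinv).
1,2: intros n; destruct (Hinv n) as (H1 & H2 & _), (HS n) as (HA & HB & _ & _);
  rewrite ?HA, ?HB; apply Hlh; auto.
destruct (nested_intervals U V) as [y Hy]; try (intros n; apply Hinv).
1,2: intros n; destruct (Hinv n) as (H1 & H2 & _), (HS n) as (_ & _ & HA & HB);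
  rewrite ?HA, ?HB; apply Hlh; auto.
assert (Hmon : forall n, a <= A n /\ B n <= b /\ c <= U n /\ V n <= d).
{ induction n as [|n IH]; [unfold A, B, U, V; simpl; lra|].
  destruct (Hinv n) as (H1 & H2 & _), (HS n) as (-> & -> & -> & ->).
  destruct (Hlh (fst (choice (s n))) _ _ H1) as (? & ? & _).
  destruct (Hlh (snd (choice (s n))) _ _ H2) as (? & ? & _). lra. }
destruct (Hloc x y) as (e & He & HP); [apply (Hx O)|apply (Hy O)|].
(* The added 1 keeps the denominator positive for a degenerate rectangle. *)
destruct (pow_lt_1_zero (/ 2)) with (y := e / (1 + (b - a) + (d - c))) as [n Hn].
{ rewrite Rabs_pos_eq; lra. }
{ apply Rdiv_lt_0_compat; lra. }
specialize (Hn n (le_n n)).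
rewrite Rabs_pos_eq in Hn by (apply pow_le; lra).
apply Rmult_lt_compat_r with (r := 1 + (b - a) + (d - c)) in Hn; [|lra].
replace (e / (1 + (b - a) + (d - c)) * (1 + (b - a) + (d - c))) with e in Hn by (field; lra).
assert (0 < (/ 2) ^ n) by (apply pow_lt; lra).
destruct (Hinv n) as (H1 & H2 & H3), (Hw n) as [W1 W2], (Hmon n) as (M1 & M2 & M3 & M4).
specialize (Hx n); specialize (Hy n).
apply H3, HP; try lra; rewrite ?W1, ?W2; nra.
Qed.

(** The integral of the form [q dx + p dy] counterclockwise around the rectangle. *)
Definition circulation (p q : R -> R -> R) (a b c d : R) : R :=
  (RInt (p b) c d - RInt (p a) c d)
  - (RInt (fun x => q x d) a b - RInt (fun x => q x c) a b).

Lemma continuity_2d_pt_slice (p : R -> R -> R) (x y : R) :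
  continuity_2d_pt p x y -> continuous (p x) y /\ continuous (fun u => p u y) x.
Proof.
intros H. apply continuity_2d_pt_filterlim in H.
split.
- apply (continuous_comp_2 (fun _ => x) (fun v : R => v) p); auto using continuous_const, continuous_id.
- apply (continuous_comp_2 (fun u : R => u) (fun _ => y) p); auto using continuous_const, continuous_id.
Qed.

Lemma ex_RInt_slice (p : R -> R -> R) (a b c d : R) :
  (forall x y, a <= x <= b -> c <= y <= d -> continuity_2d_pt p x y) ->
  (forall x u v, a <= x <= b -> c <= u <= v -> v <= d -> ex_RInt (p x) u v) /\
  (forall y u v, c <= y <= d -> a <= u <= v -> v <= b -> ex_RInt (fun x => p x y) u v).
Proof.
intros H; split; intros z u v Hz Hu Hv; apply (ex_RInt_continuous (V := R_CompleteNormedModule));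
  rewrite Rmin_left, Rmax_right by lra; intros w Hw; apply continuity_2d_pt_slice, H; lra.
Qed.

Lemma RInt_split (f : R -> R) (a b c : R) :
  ex_RInt f a b -> ex_RInt f b c -> RInt f a c = RInt f a b + RInt f b c.
Proof.
intros H1 H2. symmetry. apply (RInt_Chasles (V := R_CompleteNormedModule)); auto.
Qed.

Lemma circulation_quarters (p q : R -> R -> R) (a m b c n d : R) :
  a <= m <= b -> c <= n <= d ->
  (forall x y, a <= x <= b -> c <= y <= d -> continuity_2d_pt p x y) ->
  (forall x y, a <= x <= b -> c <= y <= d -> continuity_2d_pt q x y) ->
  circulation p q a b c d =
  circulation p q a m c n + circulation p q m b c n
  + circulation p q a m n d + circulation p q m b n d.
Proof.
intros Hm Hn Hp Hq.
destruct (ex_RInt_slice _ _ _ _ _ Hp) as [Hp1 _].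
destruct (ex_RInt_slice _ _ _ _ _ Hq) as [_ Hq2].
unfold circulation.
rewrite (RInt_split (p b) c n d), (RInt_split (p a) c n d) by (apply Hp1; lra).
rewrite (RInt_split (fun x => q x d) a m b), (RInt_split (fun x => q x c) a m b)
  by (apply Hq2; lra).
ring.
Qed.

(** Meant for two opposite sides of a rectangle, with [k] the increment predicted by the
    derivative. *)
Lemma RInt_diff_approx (f g : R -> R) (a b k M : R) :
  a <= b -> ex_RInt f a b -> ex_RInt g a b ->
  (forall t, a <= t <= b -> Rabs (f t - g t - k) <= M) ->
  Rabs (RInt f a b - RInt g a b - (b - a) * k) <= (b - a) * M.
Proof.
intros Hab Hf Hg H.
replace (RInt f a b - RInt g a b - (b - a) * k)
  with (RInt (fun t => minus (minus (f t) (g t)) k) a b).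
- apply abs_RInt_le_const; auto.
  apply (ex_RInt_minus (V := R_NormedModule)); [|apply ex_RInt_const].
  apply (ex_RInt_minus (V := R_NormedModule)); auto.
- rewrite (RInt_minus (V := R_CompleteNormedModule) (fun t => minus (f t) (g t)) (fun _ => k)).
  + rewrite (RInt_minus (V := R_CompleteNormedModule) f g), RInt_const by auto.
    reflexivity.
  + apply (ex_RInt_minus (V := R_NormedModule)); auto.
  + apply ex_RInt_const.
Qed.

(* Goursat's argument: [circulation p q] would be the double integral of
   [dp/dx - dq/dy] if the partial derivatives were continuous. *)
Lemma circulation_eq_0 (p q : R -> R -> R) (a b c d : R) :
  a <= b -> c <= d ->
  (forall x y, a <= x <= b -> c <= y <= d -> exists l m n,
     differentiable_pt_lim p x y l m /\ differentiable_pt_lim q x y n l) ->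
  circulation p q a b c d = 0.
Proof.
intros Hab Hcd Hd.
assert (Hp : forall x y, a <= x <= b -> c <= y <= d -> continuity_2d_pt p x y).
{ intros x y Hx Hy. destruct (Hd x y Hx Hy) as (l & m & n & H & _).
  apply differentiable_continuity_pt. exists l, m; exact H. }
assert (Hq : forall x y, a <= x <= b -> c <= y <= d -> continuity_2d_pt q x y).
{ intros x y Hx Hy. destruct (Hd x y Hx Hy) as (l & m & n & _ & H).
  apply differentiable_continuity_pt. exists n, l; exact H. }
destruct (ex_RInt_slice _ _ _ _ _ Hp) as [Ip _].
destruct (ex_RInt_slice _ _ _ _ _ Hq) as [_ Iq].
(* The bound is quadratic in the half perimeter because the four quarters then contribute exactly
   the bound of the whole: each has half the perimeter, hence a quarter of the bound. *)
assert (H : forall eps : posreal,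
  Rabs (circulation p q a b c d) <= 2 * eps * ((b - a) + (d - c)) ^ 2).
{ intros eps.
  apply (rectangle_bisection (fun a' b' c' d' => a <= a' <= b' -> b' <= b ->
    c <= c' <= d' -> d' <= d ->
    Rabs (circulation p q a' b' c' d') <= 2 * eps * ((b' - a') + (d' - c')) ^ 2)
    a b c d); try lra.
  - clear - Hp Hq. intros a' b' c' d' H1 H2 I1 I2 I3 I4 Ha Hb Hc Hd.
    rewrite (circulation_quarters p q a' ((a' + b') / 2) b' c' ((c' + d') / 2) d'); try lra.
    + specialize (I1 ltac:(lra) ltac:(lra) ltac:(lra) ltac:(lra)).
      specialize (I2 ltac:(lra) ltac:(lra) ltac:(lra) ltac:(lra)).
      specialize (I3 ltac:(lra) ltac:(lra) ltac:(lra) ltac:(lra)).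
      specialize (I4 ltac:(lra) ltac:(lra) ltac:(lra) ltac:(lra)).
      eapply Rle_trans; [apply Rabs_triang|].
      eapply Rle_trans; [apply Rplus_le_compat; [apply Rabs_triang|exact I4]|].
      eapply Rle_trans; [apply Rplus_le_compat_r, Rplus_le_compat; [apply Rabs_triang|exact I3]|].
      eapply Rle_trans; [do 2 apply Rplus_le_compat_r; apply Rplus_le_compat; [exact I1|exact I2]|].
      right; field.
    + intros; apply Hp; lra.
    + intros; apply Hq; lra.
  - intros x y Hx Hy.
    destruct (Hd x y Hx Hy) as (l & m & n & Dp & Dq).
    destruct (Dp eps) as [dp Dp'], (Dq eps) as [dq Dq']; clear Dp Dq; rename Dp' into Dp, Dq' into Dq.
    exists (Rmin dp dq); split; [apply Rmin_pos; apply cond_pos|].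
    intros a' b' c' d' Ha Hb Hc Hd' Hw Hh _ _ _ _.
    assert (Hnear : forall u v, a' <= u <= b' -> c' <= v <= d' ->
      Rabs (u - x) < dp /\ Rabs (v - y) < dp /\ Rabs (u - x) < dq /\ Rabs (v - y) < dq /\
      eps * Rmax (Rabs (u - x)) (Rabs (v - y)) <= eps * ((b' - a') + (d' - c'))).
    { intros u v Hu Hv.
      assert (H1 : Rabs (u - x) <= b' - a') by (apply Rabs_le; lra).
      assert (H2 : Rabs (v - y) <= d' - c') by (apply Rabs_le; lra).
      pose proof (Rmin_l dp dq); pose proof (Rmin_r dp dq).
      repeat split; try lra.
      apply Rmult_le_compat_l; [left; apply cond_pos|]. apply Rmax_lub; lra. }
    set (s := b' - a' + (d' - c')) in *.
    unfold circulation.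
    (* Between opposite sides the terms in [m] and [n] cancel, and both differences of integrals
       have the main term [l] times the area. These cancel in the circulation, which leaves only the
       errors; the factor 2 counts the two ends of each increment. *)
    pose proof (RInt_diff_approx (p b') (p a') c' d' (l * (b' - a')) (2 * (eps * s))) as E1.
    pose proof (RInt_diff_approx (fun u => q u d') (fun u => q u c') a' b' (l * (d' - c'))
      (2 * (eps * s))) as E2.
    specialize (E1 ltac:(lra) ltac:(apply Ip; lra) ltac:(apply Ip; lra)).
    specialize (E2 ltac:(lra) ltac:(apply Iq; lra) ltac:(apply Iq; lra)).
    assert (F1 : Rabs (RInt (p b') c' d' - RInt (p a') c' d' - (d' - c') * (l * (b' - a')))
      <= (d' - c') * (2 * (eps * s))).
    { apply E1. intros v Hv.
      destruct (Hnear a' v) as (N1 & N2 & _ & _ & N3); try lra.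
      destruct (Hnear b' v) as (N4 & N5 & _ & _ & N6); try lra.
      pose proof (Dp a' v N1 N2) as A1. pose proof (Dp b' v N4 N5) as A2.
      apply Rabs_le_between in A1; apply Rabs_le_between in A2. apply Rabs_le; lra. }
    assert (F2 : Rabs (RInt (fun u => q u d') a' b' - RInt (fun u => q u c') a' b'
      - (b' - a') * (l * (d' - c'))) <= (b' - a') * (2 * (eps * s))).
    { apply E2. intros u Hu.
      destruct (Hnear u c') as (_ & _ & N1 & N2 & N3); try lra.
      destruct (Hnear u d') as (_ & _ & N4 & N5 & N6); try lra.
      pose proof (Dq u c' N1 N2) as A1. pose proof (Dq u d' N4 N5) as A2.
      apply Rabs_le_between in A1; apply Rabs_le_between in A2. apply Rabs_le; lra. }
    apply Rabs_le_between in F1; apply Rabs_le_between in F2.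
    apply Rabs_le. replace (2 * eps * s ^ 2) with
      ((d' - c') * (2 * (eps * s)) + (b' - a') * (2 * (eps * s))) by (unfold s; ring).
    lra. }
set (s := b - a + (d - c)) in *.
destruct (Req_dec (circulation p q a b c d) 0) as [|Hn]; [assumption|exfalso].
apply Rabs_pos_lt in Hn.
(* With this [eps] the bound is less than half of the circulation it should dominate. *)
assert (He : 0 < Rabs (circulation p q a b c d) / (4 * (1 + s ^ 2))).
{ apply Rdiv_lt_0_compat; [assumption|]. generalize (pow2_ge_0 s); lra. }
specialize (H (mkposreal _ He)); simpl in H.
generalize (pow2_ge_0 s); intros Hs.
assert (2 * (Rabs (circulation p q a b c d) / (4 * (1 + s ^ 2))) * s ^ 2
  = Rabs (circulation p q a b c d) * (s ^ 2 / (2 * (1 + s ^ 2)))) by (field; lra).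
simpl in *. rewrite H0 in H.
assert (s * (s * 1) / (2 * (1 + s * (s * 1))) < 1).
{ apply Rlt_div_l; lra. }
nra.
Qed.

(** * Continuity and differentiability of complex functions *)

Lemma Cconj_RtoC (x : R) : Cconj (RtoC x) = RtoC x.
Proof. unfold Cconj, RtoC; simpl; f_equal; ring. Qed.

Lemma continuous_C_iff {U : UniformSpace} (f : U -> C) (x : U) :
  continuous f x <->
  continuous (fun u => Re (f u)) x /\ continuous (fun u => Im (f u)) x.
Proof.
split.
- intros H; split; apply (continuous_comp f _ x H).
  + destruct (f x); apply continuous_fst.
  + destruct (f x); apply continuous_snd.
- intros [H1 H2]. apply filterlim_locally; intros eps.
  pose proof (proj1 (filterlim_locally _ _) H1 eps) as L1.
  pose proof (proj1 (filterlim_locally _ _) H2 eps) as L2.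
  generalize (filter_and _ _ L1 L2); apply filter_imp.
  intros u [A1 A2]; split; assumption.
Qed.

Lemma continuous_Re {U : UniformSpace} (f : U -> C) (x : U) :
  continuous f x -> continuous (fun u => Re (f u)) x.
Proof. intros H; apply (proj1 (continuous_C_iff f x) H). Qed.

Lemma continuous_Im {U : UniformSpace} (f : U -> C) (x : U) :
  continuous f x -> continuous (fun u => Im (f u)) x.
Proof. intros H; apply (proj1 (continuous_C_iff f x) H). Qed.

Lemma continuous_Cplus {U : UniformSpace} (f g : U -> C) (x : U) :
  continuous f x -> continuous g x -> continuous (fun u => (f u + g u)%C) x.
Proof.
intros [H1 H2]%continuous_C_iff [H3 H4]%continuous_C_iff.
apply continuous_C_iff; split; simpl.
- exact (continuous_plus (V := R_NormedModule) _ _ _ H1 H3).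
- exact (continuous_plus (V := R_NormedModule) _ _ _ H2 H4).
Qed.

Lemma continuous_Copp {U : UniformSpace} (f : U -> C) (x : U) :
  continuous f x -> continuous (fun u => (- f u)%C) x.
Proof.
intros [H1 H2]%continuous_C_iff.
apply continuous_C_iff; split; simpl.
- exact (continuous_opp (V := R_NormedModule) _ _ H1).
- exact (continuous_opp (V := R_NormedModule) _ _ H2).
Qed.

Lemma continuous_Cminus {U : UniformSpace} (f g : U -> C) (x : U) :
  continuous f x -> continuous g x -> continuous (fun u => (f u - g u)%C) x.
Proof. intros H1 H2; apply continuous_Cplus, continuous_Copp; assumption. Qed.

Lemma continuous_Cmult {U : UniformSpace} (f g : U -> C) (x : U) :
  continuous f x -> continuous g x -> continuous (fun u => (f u * g u)%C) x.
Proof.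
intros [H1 H2]%continuous_C_iff [H3 H4]%continuous_C_iff.
apply continuous_C_iff; split; simpl.
- apply (continuous_minus (V := R_NormedModule));
    apply (continuous_mult (K := R_AbsRing)); assumption.
- apply (continuous_plus (V := R_NormedModule));
    apply (continuous_mult (K := R_AbsRing)); assumption.
Qed.

Lemma continuous_Rinv {U : UniformSpace} (f : U -> R) (x : U) :
  continuous f x -> f x <> 0 -> continuous (fun u => / f u) x.
Proof.
intros H Hx. apply (continuous_comp f Rinv); [assumption|].
apply (continuous_Rinv_comp (fun y => y)); [apply continuous_id|assumption].
Qed.

Lemma continuous_Cinv {U : UniformSpace} (f : U -> C) (x : U) :
  continuous f x -> f x <> 0 -> continuous (fun u => (/ f u)%C) x.
Proof.
intros [H1 H2]%continuous_C_iff Hx.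
assert (Hn : Re (f x) ^ 2 + Im (f x) ^ 2 <> 0).
{ rewrite <- Cmod2_alt. apply pow_nonzero.
  apply Rgt_not_eq, Cmod_gt_0; assumption. }
assert (H3 : continuous (fun u => / (Re (f u) ^ 2 + Im (f u) ^ 2)) x).
{ apply continuous_Rinv; [|assumption]. simpl.
  apply (continuous_plus (V := R_NormedModule)).
  - apply (continuous_mult (K := R_AbsRing)); [exact H1|].
    apply (continuous_mult (K := R_AbsRing)); [exact H1|apply continuous_const].
  - apply (continuous_mult (K := R_AbsRing)); [exact H2|].
    apply (continuous_mult (K := R_AbsRing)); [exact H2|apply continuous_const]. }
apply continuous_C_iff; split; simpl.
- exact (continuous_mult (K := R_AbsRing) _ _ _ H1 H3).
- exact (continuous_mult (K := R_AbsRing) _ _ _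
    (continuous_opp (V := R_NormedModule) _ _ H2) H3).
Qed.

Lemma continuous_Cdiv {U : UniformSpace} (f g : U -> C) (x : U) :
  continuous f x -> continuous g x -> g x <> 0 -> continuous (fun u => (f u / g u)%C) x.
Proof. intros; apply continuous_Cmult, continuous_Cinv; assumption. Qed.

Lemma continuous_Cconj {U : UniformSpace} (f : U -> C) (x : U) :
  continuous f x -> continuous (fun u => Cconj (f u)) x.
Proof.
intros [H1 H2]%continuous_C_iff. apply continuous_C_iff; split; simpl.
- exact H1.
- exact (continuous_opp (V := R_NormedModule) _ _ H2).
Qed.

Lemma continuous_RtoC (x : R) : continuous RtoC x.
Proof. apply continuous_C_iff; split; simpl; [apply continuous_id|apply continuous_const]. Qed.

Lemma continuous_RtoC_1_minus (x : R) : continuous (fun r => RtoC (1 - r)) x.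
Proof.
apply (continuous_comp (fun r : R => 1 - r) RtoC); [|apply continuous_RtoC].
apply (continuous_minus (V := R_NormedModule)); [apply continuous_const|apply continuous_id].
Qed.

Lemma continuous_Cmod {U : UniformSpace} (f : U -> C) (x : U) :
  continuous f x -> continuous (fun u => Cmod (f u)) x.
Proof.
intros H. apply (continuous_comp f Cmod); [assumption|].
apply (continuous_ext (fun z : C => norm (z : C_R_NormedModule)) Cmod).
- intros z. symmetry; apply Cmod_norm.
- exact (filterlim_norm (V := C_R_NormedModule) (f x)).
Qed.

Lemma sqrt_2_lt_2 : sqrt 2 < 2.
Proof. rewrite <- (sqrt_Rsqr 2) at 2 by lra. apply sqrt_lt_1; unfold Rsqr; lra. Qed.

(** The balls of [C] are squares, those of the product [R * R]. Passing from them to discs loses a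
    factor [sqrt 2], absorbed by halving the radius. *)
Lemma locally_C_Cmod (z : C) (P : C -> Prop) :
  locally z P <-> exists d : posreal, forall w, Cmod (w - z) < d -> P w.
Proof.
split.
- intros [d Hd]. exists d; intros w Hw. apply Hd.
  apply C_NormedModule_mixin_compat1; exact Hw.
- intros [d Hd].
  assert (Hd2 : 0 < d / 2) by (generalize (cond_pos d); lra).
  exists (mkposreal _ Hd2); intros w Hw. apply Hd.
  pose proof (C_NormedModule_mixin_compat2 z w _ Hw) as H; simpl in H.
  eapply Rlt_trans; [exact H|].
  pose proof sqrt_2_lt_2.
  generalize (cond_pos d); nra.
Qed.

Lemma locally_disk (R0 : R) (z : C) : Cmod z < R0 -> locally z (fun w => Cmod w < R0).
Proof.
intros H. apply locally_C_Cmod.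
assert (Hd : 0 < R0 - Cmod z) by lra.
exists (mkposreal _ Hd); simpl; intros w Hw.
replace w with (z + (w - z))%C by ring.
eapply Rle_lt_trans; [apply Cmod_triangle|lra].
Qed.

Lemma locally_neq (z a : C) : z <> a -> locally z (fun w => w <> a).
Proof.
intros H. apply locally_C_Cmod.
assert (Hd : 0 < Cmod (a - z)) by (apply Cmod_gt_0; intros E; apply H; symmetry; apply Ceq_minus, E).
exists (mkposreal _ Hd); simpl; intros w Hw ->. lra.
Qed.

Local Notation is_Cderive := (is_derive (K := C_AbsRing) (V := C_NormedModule)).
Local Notation ex_Cderive := (ex_derive (K := C_AbsRing) (V := C_NormedModule)).

Lemma is_Cderive_eps (f : C -> C) (z l : C) :
  is_Cderive f z l <->
  forall eps : posreal, locally z (fun w =>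
    Cmod (f w - f z - l * (w - z)) <= eps * Cmod (w - z)).
Proof.
split.
- intros [_ H] eps. apply locally_C.
  generalize (H z (fun P HP => HP) eps). apply filter_imp. intros w Hw.
  replace (l * (w - z))%C with ((w - z) * l)%C by ring. exact Hw.
- intros H. split.
  + apply is_linear_scal_l.
  + intros x Hx. apply (is_filter_lim_locally_unique (V := AbsRing_NormedModule C_AbsRing)) in Hx. subst x.
    intros eps. apply locally_C. generalize (H eps). apply filter_imp. intros w Hw.
    replace (l * (w - z))%C with ((w - z) * l)%C in Hw by ring. exact Hw.
Qed.

(** Caratheodory's criterion: with a slope function continuous at [z], the product and inverse rules
    become algebraic identities, and difference quotients extend continuously across [z]. *)
Lemma is_Cderive_slope (f : C -> C) (z l : C) :
  is_Cderive f z l <->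
  exists phi : C -> C, continuous phi z /\ phi z = l /\
    locally z (fun w => f w = (f z + phi w * (w - z))%C).
Proof.
split.
- intros H.
  exists (fun w => if Ceq_dec w z then l else ((f w - f z) / (w - z))%C). split; [|split].
  + apply filterlim_locally; intros eps.
    destruct (Ceq_dec z z) as [_|n]; [|congruence].
    assert (He : 0 < eps / 2) by (generalize (cond_pos eps); lra).
    pose proof (proj1 (is_Cderive_eps f z l) H (mkposreal _ He)) as L.
    generalize L; apply filter_imp. intros w Hw; simpl in Hw.
    destruct (Ceq_dec w z) as [_|Hn]; [apply ball_center|].
    apply C_NormedModule_mixin_compat1.
    assert (Hz : (w - z)%C <> 0) by (intros E; apply Hn, Ceq_minus, E).
    assert (Hp : 0 < Cmod (w - z)) by (apply Cmod_gt_0; assumption).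
    change (Cmod ((f w - f z) / (w - z) - l) < eps).
    replace ((f w - f z) / (w - z) - l)%C with ((f w - f z - l * (w - z)) / (w - z))%C
      by (field; assumption).
    rewrite Cmod_div by assumption. apply Rlt_div_l; [assumption|].
    eapply Rle_lt_trans; [exact Hw|]. generalize (cond_pos eps); nra.
  + destruct (Ceq_dec z z); congruence.
  + apply filter_forall; intros w. destruct (Ceq_dec w z) as [->|Hn]; [ring|].
    field. intros E; apply Hn, Ceq_minus, E.
- intros (phi & Hc & <- & He). apply is_Cderive_eps. intros eps.
  assert (He2 : 0 < eps / sqrt 2).
  { apply Rdiv_lt_0_compat; [apply cond_pos|apply sqrt_lt_R0; lra]. }
  pose proof (proj1 (filterlim_locally _ _) Hc (mkposreal _ He2)) as L.
  generalize (filter_and _ _ L He); apply filter_imp. intros w [Hb ->].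
  apply C_NormedModule_mixin_compat2 in Hb; simpl in Hb.
  replace (sqrt 2 * (eps / sqrt 2)) with (eps : R) in Hb
    by (field; apply Rgt_not_eq, sqrt_lt_R0; lra).
  replace (f z + phi w * (w - z) - f z - phi z * (w - z))%C
    with ((phi w - phi z) * (w - z))%C by ring.
  rewrite Cmod_mult. apply Rmult_le_compat_r; [apply Cmod_ge_0|]. left; exact Hb.
Qed.

Lemma ex_Cderive_continuous (f : C -> C) (z : C) : ex_Cderive f z -> continuous f z.
Proof.
intros [l Hl]. apply is_Cderive_slope in Hl. destruct Hl as (phi & Hc & _ & He).
apply (continuous_ext_loc _ (fun w => (f z + phi w * (w - z))%C)).
- generalize He; apply filter_imp; intros w Hw; symmetry; exact Hw.
- apply continuous_Cplus; [apply continuous_const|].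
  apply continuous_Cmult; [assumption|].
  apply continuous_Cminus; [apply continuous_id|apply continuous_const].
Qed.

Lemma ex_Cderive_const (c z : C) : ex_Cderive (fun _ => c) z.
Proof. exists (RtoC 0). exact (is_derive_const (K := C_AbsRing) (V := C_NormedModule) c z). Qed.

Lemma is_Cderive_id (z : C) : is_Cderive (fun w => w) z (RtoC 1).
Proof.
apply is_Cderive_slope. exists (fun _ => RtoC 1). split; [apply continuous_const|split; [reflexivity|]].
apply filter_forall; intros w; change C in w; simpl; ring.
Qed.

Lemma ex_Cderive_id (z : C) : ex_Cderive (fun w => w) z.
Proof. exists (RtoC 1); apply is_Cderive_id. Qed.

Lemma ex_Cderive_plus (f g : C -> C) (z : C) :
  ex_Cderive f z -> ex_Cderive g z -> ex_Cderive (fun w => (f w + g w)%C) z.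
Proof. exact (ex_derive_plus (K := C_AbsRing) (V := C_NormedModule) f g z). Qed.

Lemma ex_Cderive_minus (f g : C -> C) (z : C) :
  ex_Cderive f z -> ex_Cderive g z -> ex_Cderive (fun w => (f w - g w)%C) z.
Proof. exact (ex_derive_minus (K := C_AbsRing) (V := C_NormedModule) f g z). Qed.

Lemma ex_Cderive_mult (f g : C -> C) (z : C) :
  ex_Cderive f z -> ex_Cderive g z -> ex_Cderive (fun w => (f w * g w)%C) z.
Proof.
intros [l Hf] Hg. pose proof (ex_Cderive_continuous g z Hg) as Cg. destruct Hg as [m Hg].
apply is_Cderive_slope in Hf; apply is_Cderive_slope in Hg.
destruct Hf as (phi & Cphi & _ & Ef), Hg as (gam & Cgam & _ & Eg).
exists (phi z * g z + f z * gam z)%C. apply is_Cderive_slope.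
exists (fun w => phi w * g w + f z * gam w)%C. split; [|split; [reflexivity|]].
- apply continuous_Cplus; apply continuous_Cmult; auto using continuous_const.
- generalize (filter_and _ _ Ef Eg); apply filter_imp; intros w [E1 E2].
  rewrite E1, E2; ring.
Qed.

Lemma ex_Cderive_inv (f : C -> C) (z : C) :
  ex_Cderive f z -> f z <> 0 -> ex_Cderive (fun w => (/ f w)%C) z.
Proof.
intros Hf Hn. pose proof (ex_Cderive_continuous f z Hf) as Cf. destruct Hf as [l Hf].
apply is_Cderive_slope in Hf. destruct Hf as (phi & Cphi & _ & Ef).
exists (- phi z / (f z * f z))%C. apply is_Cderive_slope.
exists (fun w => - phi w / (f w * f z))%C. split; [|split; [reflexivity|]].
- apply continuous_Cdiv; [apply continuous_Copp; assumption| |apply Cmult_neq_0; assumption].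
  apply continuous_Cmult; [assumption|apply continuous_const].
- pose proof (Cf _ (locally_neq (f z) 0 Hn)) as L.
  generalize (filter_and _ _ Ef L); apply filter_imp; intros w [E1 E2].
  assert (E3 : (phi w * (w - z))%C = (f w - f z)%C) by (rewrite E1; ring).
  replace (- phi w / (f w * f z) * (w - z))%C
    with (- (phi w * (w - z)) / (f w * f z))%C by (field; auto).
  rewrite E3; field; auto.
Qed.

Lemma ex_Cderive_div (f g : C -> C) (z : C) :
  ex_Cderive f z -> ex_Cderive g z -> g z <> 0 -> ex_Cderive (fun w => (f w / g w)%C) z.
Proof. intros; apply ex_Cderive_mult, ex_Cderive_inv; assumption. Qed.

Lemma ex_Cderive_ext_loc (f g : C -> C) (z : C) :
  locally z (fun w => f w = g w) -> ex_Cderive f z -> ex_Cderive g z.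
Proof.
intros H. apply (ex_derive_ext_loc (K := C_AbsRing) (V := C_NormedModule)).
apply locally_C; exact H.
Qed.

(** Restates at type [C] an equation typed by a carrier convertible to it, so that [ring] and
    [field] recognize it. *)
Ltac Ceq := match goal with |- ?x = ?y => change (x = y :> C) end.

Ltac Ccont := repeat match goal with
  | |- continuous (fun _ => ?c) _ => apply continuous_const
  | |- continuous (fun x => x) _ => apply continuous_id
  | |- continuous (fun x => Cconj (@?f x)) _ => apply (continuous_Cconj f)
  | |- continuous (fun x => Copp (@?f x)) _ => apply (continuous_Copp f)
  | |- continuous (fun x => Cinv (@?f x)) _ => apply (continuous_Cinv f)
  | |- continuous (fun x => Cplus (@?f x) (@?g x)) _ => apply (continuous_Cplus f g)
  | |- continuous (fun x => Cminus (@?f x) (@?g x)) _ => apply (continuous_Cminus f g)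
  | |- continuous (fun x => Cmult (@?f x) (@?g x)) _ => apply (continuous_Cmult f g)
  | |- continuous (fun x => Cdiv (@?f x) (@?g x)) _ => apply (continuous_Cdiv f g)
  | |- continuous _ _ => assumption
  end.

Ltac Cderiv := repeat match goal with
  | |- ex_derive (fun _ => ?c) _ => apply ex_Cderive_const
  | |- ex_derive (fun x => x) _ => apply ex_Cderive_id
  | |- ex_derive (fun x => Cinv (@?f x)) _ => apply (ex_Cderive_inv f)
  | |- ex_derive (fun x => Cplus (@?f x) (@?g x)) _ => apply (ex_Cderive_plus f g)
  | |- ex_derive (fun x => Cminus (@?f x) (@?g x)) _ => apply (ex_Cderive_minus f g)
  | |- ex_derive (fun x => Cmult (@?f x) (@?g x)) _ => apply (ex_Cderive_mult f g)
  | |- ex_derive (fun x => Cdiv (@?f x) (@?g x)) _ => apply (ex_Cderive_div f g)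
  | |- ex_derive _ _ => assumption
  end.

(** * Means over circles and Cauchy's formula *)

(** The Cauchy-Riemann equations, together with total differentiability, which is what Goursat's
    argument consumes. *)
Lemma is_Cderive_differentiable (f : C -> C) (x y : R) (l : C) :
  is_Cderive f (x, y) l ->
  differentiable_pt_lim (fun u v => Re (f (u, v))) x y (Re l) (- Im l) /\
  differentiable_pt_lim (fun u v => Im (f (u, v))) x y (Im l) (Re l).
Proof.
intros H.
assert (Hm : forall eps : posreal, locally_2d (fun u v =>
  Cmod (f (u, v) - f (x, y) - l * ((u, v) - (x, y))) <=
  eps * Rmax (Rabs (u - x)) (Rabs (v - y))) x y).
{ intros eps.
  assert (He : 0 < eps / 2) by (generalize (cond_pos eps); lra).
  pose proof (proj1 (is_Cderive_eps f (x, y) l) H (mkposreal _ He)) as L; simpl in L.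
  apply locally_2d_locally. generalize L; apply filter_imp. intros [u v] Hw; simpl in *.
  eapply Rle_trans; [exact Hw|].
  pose proof (Cmod_2Rmax ((u, v) - (x, y))) as Hs; simpl in Hs.
  change (u + - x) with (u - x) in Hs; change (v + - y) with (v - y) in Hs.
  pose proof sqrt_2_lt_2.
  assert (0 <= Rmax (Rabs (u - x)) (Rabs (v - y))).
  { eapply Rle_trans; [apply Rabs_pos|apply Rmax_l]. }
  generalize (cond_pos eps); intros Hp.
  apply Rle_trans with (eps / 2 * (2 * Rmax (Rabs (u - x)) (Rabs (v - y)))); [|right; field].
  apply Rmult_le_compat_l; [lra|]. eapply Rle_trans; [exact Hs|]. nra. }
split; intros eps; generalize (Hm eps); apply locally_2d_impl, locally_2d_forall; intros u v Hw;
  (eapply Rle_trans; [|exact Hw]).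
- eapply Rle_trans; [|apply re_le_Cmod]. right; f_equal; simpl; unfold Re, Im; ring.
- eapply Rle_trans; [|eapply Rle_trans; [apply Rmax_r|apply Rmax_Cmod]].
  right; f_equal; simpl; unfold Re, Im; ring.
Qed.

Lemma differentiable_pt_lim_mult (x y : R) :
  differentiable_pt_lim Rmult x y y x.
Proof.
intros eps. exists eps. intros u v Hu Hv.
replace (u * v - x * y - (y * (u - x) + x * (v - y))) with ((u - x) * (v - y)) by ring.
rewrite Rabs_mult. apply Rmult_le_compat; try apply Rabs_pos; [lra|apply Rmax_r].
Qed.

Lemma differentiable_pt_lim_snd (f : R -> R) (x y l : R) :
  derivable_pt_lim f y l -> differentiable_pt_lim (fun _ v => f v) x y 0 l.
Proof.
intros H eps. destruct (differentiable_pt_lim_proj1_0 f y x l H eps) as [d Hd].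
exists d; intros u v Hu Hv. specialize (Hd v u Hv Hu).
rewrite Rmax_comm. eapply Rle_trans; [|exact Hd]. right; f_equal; ring.
Qed.

Definition polar (r t : R) : C := (r * cos t, r * sin t).

Lemma Cmod_polar (r t : R) : Cmod (polar r t) = Rabs r.
Proof.
unfold Cmod, polar; simpl. rewrite <- sqrt_Rsqr_abs. f_equal.
generalize (sin2_cos2 t); unfold Rsqr; intros H.
replace (r * cos t * (r * cos t * 1) + r * sin t * (r * sin t * 1))
  with (r * r * (sin t * sin t + cos t * cos t)) by ring.
rewrite H; ring.
Qed.

Lemma polar_0 (t : R) : polar 0 t = RtoC 0.
Proof. unfold polar, RtoC; f_equal; ring. Qed.

Lemma continuous_polar (z : R * R) :
  continuous (U := prod_UniformSpace R_UniformSpace R_UniformSpace)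
    (fun z => polar (fst z) (snd z)) z.
Proof.
destruct z as [r t]. apply continuous_C_iff; split; simpl.
- apply (continuous_mult (K := R_AbsRing)); [apply continuous_fst|].
  apply (continuous_comp snd cos); [apply continuous_snd|apply continuous_cos].
- apply (continuous_mult (K := R_AbsRing)); [apply continuous_fst|].
  apply (continuous_comp snd sin); [apply continuous_snd|apply continuous_sin].
Qed.

Lemma continuous_polar_angle (g : C -> C) (r t : R) :
  continuous g (polar r t) -> continuous (fun s => g (polar r s)) t.
Proof.
intros H. apply (continuous_comp (polar r) g); [|assumption].
apply (continuous_comp_2 (fun _ : R => r) (fun s : R => s) polar);
  [apply continuous_const|apply continuous_id|apply continuous_polar].
Qed.

Lemma differentiable_pt_lim_polar (f : R -> R -> R) (r t a b : R) :
  differentiable_pt_lim f (r * cos t) (r * sin t) a b ->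
  differentiable_pt_lim (fun r t => f (r * cos t) (r * sin t)) r t
    (a * cos t + b * sin t) (r * (b * cos t - a * sin t)).
Proof.
intros H.
assert (Hc : differentiable_pt_lim (fun r t => r * cos t) r t (cos t) (r * - sin t)).
{ pose proof (differentiable_pt_lim_comp Rmult (fun u _ => u) (fun _ v => cos v) r t
    (cos t) r 1 0 0 (- sin t) (differentiable_pt_lim_mult _ _)
    (differentiable_pt_lim_proj1_0 (fun u => u) r t 1 (derivable_pt_lim_id r))
    (differentiable_pt_lim_snd cos r t _ (derivable_pt_lim_cos t))) as Hc.
  replace (cos t) with (cos t * 1 + r * 0) at 1 by ring.
  replace (r * - sin t) with (cos t * 0 + r * - sin t) by ring. exact Hc. }
assert (Hs : differentiable_pt_lim (fun r t => r * sin t) r t (sin t) (r * cos t)).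
{ pose proof (differentiable_pt_lim_comp Rmult (fun u _ => u) (fun _ v => sin v) r t
    (sin t) r 1 0 0 (cos t) (differentiable_pt_lim_mult _ _)
    (differentiable_pt_lim_proj1_0 (fun u => u) r t 1 (derivable_pt_lim_id r))
    (differentiable_pt_lim_snd sin r t _ (derivable_pt_lim_sin t))) as Hs.
  replace (sin t) with (sin t * 1 + r * 0) at 1 by ring.
  replace (r * cos t) with (sin t * 0 + r * cos t) by ring. exact Hs. }
replace (r * (b * cos t - a * sin t)) with (a * (r * - sin t) + b * (r * cos t)) by ring.
exact (differentiable_pt_lim_comp _ _ _ _ _ _ _ _ _ _ _ H Hc Hs).
Qed.

Lemma differentiable_pt_lim_div_fst (f : R -> R -> R) (x y a b : R) :
  x <> 0 -> differentiable_pt_lim f x y a b ->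
  differentiable_pt_lim (fun u v => f u v * / u) x y (a * / x - f x y * / x ^ 2) (b * / x).
Proof.
intros Hx H.
assert (Hi : derivable_pt_lim Rinv x (- / x ^ 2)).
{ apply is_derive_Reals. apply (is_derive_ext (fun u => / u)); [reflexivity|].
  auto_derive; [assumption|]. field; assumption. }
pose proof (differentiable_pt_lim_comp Rmult f (fun u _ => / u) x y
  (/ x) (f x y) a b (- / x ^ 2) 0 (differentiable_pt_lim_mult _ _) H
  (differentiable_pt_lim_proj1_0 Rinv x y _ Hi)) as Hm.
replace (a * / x - f x y * / x ^ 2) with (/ x * a + f x y * - / x ^ 2) by (field; assumption).
replace (b * / x) with (/ x * b + f x y * 0) by ring. exact Hm.
Qed.

Definition circle_mean (g : C -> C) (r : R) : C :=
  (RInt (fun t => Re (g (polar r t))) 0 (2 * PI) / (2 * PI),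
   RInt (fun t => Im (g (polar r t))) 0 (2 * PI) / (2 * PI)).

(* The Cauchy-Riemann equations in polar coordinates are [u_r = (v/r)_t] and
   [v_r = (-u/r)_t]. *)
Lemma circle_mean_const (g : C -> C) (r1 r2 : R) :
  0 < r1 <= r2 -> (forall z, r1 <= Cmod z <= r2 -> ex_Cderive g z) ->
  circle_mean g r1 = circle_mean g r2.
Proof.
intros Hr Hg. pose proof PI_RGT_0 as HPI.
assert (Hu : circulation (fun r t => Re (g (polar r t)))
  (fun r t => Im (g (polar r t)) * / r) r1 r2 0 (2 * PI) = 0).
{ apply circulation_eq_0; try lra. intros r t Hr' _.
  destruct (Hg (polar r t)) as [l Hl].
  { rewrite Cmod_polar, Rabs_pos_eq; lra. }
  apply is_Cderive_differentiable in Hl. destruct Hl as [Du Dv].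
  apply differentiable_pt_lim_polar in Du; apply differentiable_pt_lim_polar in Dv.
  eapply differentiable_pt_lim_div_fst in Dv; [|lra].
  do 3 eexists; split; [exact Du|].
  replace (Re l * cos t + - Im l * sin t)
    with (r * (Re l * cos t - Im l * sin t) * / r) by (field; lra).
  exact Dv. }
assert (Hv : circulation (fun r t => Im (g (polar r t)))
  (fun r t => - Re (g (polar r t)) * / r) r1 r2 0 (2 * PI) = 0).
{ apply circulation_eq_0; try lra. intros r t Hr' _.
  destruct (Hg (polar r t)) as [l Hl].
  { rewrite Cmod_polar, Rabs_pos_eq; lra. }
  (* The real part enters with a minus sign, so its derivatives are read off [- g]. *)
  assert (Hl' : is_Cderive (fun z => (- g z)%C) (polar r t) (- l)%C).
  { exact (is_derive_opp (K := C_AbsRing) (V := C_NormedModule) g _ l Hl). }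
  apply is_Cderive_differentiable in Hl. destruct Hl as [_ Dv].
  apply is_Cderive_differentiable in Hl'. destruct Hl' as [Du _].
  apply differentiable_pt_lim_polar in Du; apply differentiable_pt_lim_polar in Dv.
  eapply differentiable_pt_lim_div_fst in Du; [|lra].
  do 3 eexists; split; [exact Dv|].
  replace (Im l * cos t + Re l * sin t)
    with (r * (- Im (- l)%C * cos t - Re (- l)%C * sin t) * / r)
    by (rewrite re_opp, im_opp; field; lra).
  exact Du. }
unfold circulation in Hu, Hv.
(* By periodicity the sides [t = 0] and [t = 2 pi] of the polar rectangle cancel, and only the two
   circles remain. *)
assert (E : forall r, polar r (2 * PI) = polar r 0).
{ intros r; unfold polar. rewrite cos_2PI, sin_2PI, cos_0, sin_0; reflexivity. }
rewrite (RInt_ext (fun x => Im (g (polar x (2 * PI))) * / x)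
  (fun x => Im (g (polar x 0)) * / x)) in Hu by (intros; rewrite E; reflexivity).
rewrite (RInt_ext (fun x => - Re (g (polar x (2 * PI))) * / x)
  (fun x => - Re (g (polar x 0)) * / x)) in Hv by (intros; rewrite E; reflexivity).
unfold circle_mean. f_equal; f_equal; lra.
Qed.

Lemma continuous_RInt_param (f : R -> R -> R) (a b x : R) :
  a <= b -> (forall y, a <= y <= b -> continuity_2d_pt f x y) ->
  locally x (fun u => ex_RInt (f u) a b) ->
  continuous (fun u => RInt (f u) a b) x.
Proof.
intros Hab Hf Hex.
apply filterlim_locally; intros eps.
assert (He : 0 < eps / (b - a + 1)) by (apply Rdiv_lt_0_compat; [apply cond_pos|lra]).
destruct (uniform_continuity_2d_1d' f a b x Hf (mkposreal _ He)) as [d Hd]; simpl in Hd.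
assert (Hl : locally x (fun u => Rabs (u - x) < d)) by (exists d; intros u Hu; exact Hu).
generalize (filter_and _ _ Hex Hl); apply filter_imp. intros u [Hu Hux].
pose proof (locally_singleton _ _ Hex) as Hx.
change (Rabs (RInt (f u) a b - RInt (f x) a b) < eps).
pose proof (RInt_diff_approx (f u) (f x) a b 0 (eps / (b - a + 1)) Hab Hu Hx) as H.
rewrite Rmult_0_r, Rminus_0_r in H.
eapply Rle_lt_trans; [apply H|].
- intros t Ht. rewrite Rminus_0_r. left.
  apply Rabs_lt_between in Hux.
  apply Hd; try lra. rewrite Rminus_diag, Rabs_R0; apply cond_pos.
- replace ((b - a) * (eps / (b - a + 1))) with (eps * ((b - a) / (b - a + 1))) by (field; lra).
  rewrite <- (Rmult_1_r eps) at 2. apply Rmult_lt_compat_l; [apply cond_pos|].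
  apply Rlt_div_l; lra.
Qed.

Lemma continuous_circle_mean (g : C -> C) (R0 r : R) :
  Rabs r < R0 -> (forall z, Cmod z < R0 -> continuous g z) ->
  continuous (circle_mean g) r.
Proof.
intros Hr Hg. pose proof PI_RGT_0 as HPI.
assert (H : forall p : C -> R, (forall z, Cmod z < R0 -> continuous (fun z => p (g z)) z) ->
  continuous (fun r => RInt (fun t => p (g (polar r t))) 0 (2 * PI) / (2 * PI)) r).
{ intros p Hp.
  assert (H2 : forall r t, Rabs r < R0 -> continuity_2d_pt (fun r t => p (g (polar r t))) r t).
  { intros s t Hs. apply continuity_2d_pt_filterlim.
    apply (continuous_comp (fun z : R * R => polar (fst z) (snd z)) (fun z => p (g z)) (s, t)).
    - apply continuous_polar.
    - apply Hp. simpl. rewrite Cmod_polar; assumption. }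
  apply (continuous_mult (K := R_AbsRing)); [|apply continuous_const].
  apply (continuous_RInt_param (fun r t => p (g (polar r t)))); [lra|auto|].
  assert (Hd : 0 < R0 - Rabs r) by lra.
  exists (mkposreal _ Hd). intros s Hs. change (Rabs (s - r) < R0 - Rabs r) in Hs.
  apply (ex_RInt_continuous (V := R_CompleteNormedModule)). intros t _.
  apply (continuity_2d_pt_slice (fun r t => p (g (polar r t)))), H2.
  replace s with (r + (s - r)) by ring. eapply Rle_lt_trans; [apply Rabs_triang|lra]. }
apply continuous_C_iff; split; simpl; apply H; intros z Hz.
- apply continuous_Re; auto.
- apply continuous_Im; auto.
Qed.

(** Lets circle means reach radii at which differentiability is not known: these are placed at the
    ends of an interval, where continuity is enough. *)
Lemma continuous_const_interior (m : R -> C) (a b : R) :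
  a <= b -> continuous m a -> continuous m b ->
  (forall x y, a < x <= y -> y < b -> m x = m y) -> m a = m b.
Proof.
intros Hab Ha Hb Hc. destruct Hab as [Hab| ->]; [|reflexivity].
assert (H : forall e, continuous m e ->
  (forall d : posreal, exists x, Rabs (x - e) < d /\ m x = m ((a + b) / 2)) ->
  m e = m ((a + b) / 2)).
{ intros e He Hx. apply NNPP; intros Hn.
  destruct (He _ (locally_neq _ _ Hn)) as [d Hd].
  destruct (Hx d) as (x & H1 & H2). apply (Hd x); assumption. }
assert (Hm : forall x, a < x < b -> m x = m ((a + b) / 2)).
{ intros x Hx. destruct (Rle_dec x ((a + b) / 2)); [apply Hc; lra|symmetry; apply Hc; lra]. }
rewrite (H a Ha), (H b Hb); [reflexivity| |]; intros d;
  set (s := Rmin (d / 2) ((b - a) / 2));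
  assert (0 < s) by (apply Rmin_pos; generalize (cond_pos d); lra);
  assert (s <= d / 2) by apply Rmin_l; assert (s <= (b - a) / 2) by apply Rmin_r;
  generalize (cond_pos d); intros.
- exists (b - s); split; [apply Rabs_def1; lra|apply Hm; lra].
- exists (a + s); split; [apply Rabs_def1; lra|apply Hm; lra].
Qed.

(** The exceptional radius [s] serves difference quotients, which are only known to be continuous at
    their base point. The means are constant on each side of [s], and continuity joins the sides to
    each other and to radius 0. *)
Lemma mean_value_property (g : C -> C) (R0 s r : R) :
  0 <= r < R0 -> (forall z, Cmod z < R0 -> continuous g z) ->
  (forall z, 0 < Cmod z < R0 -> Cmod z <> s -> ex_Cderive g z) ->
  circle_mean g r = g 0.
Proof.
intros Hr Hc Hd. pose proof PI_RGT_0 as HPI.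
transitivity (circle_mean g 0).
- assert (Hcm : forall x, 0 <= x <= r -> continuous (circle_mean g) x).
  { intros x Hx. apply (continuous_circle_mean g R0); [rewrite Rabs_pos_eq; lra|assumption]. }
  symmetry.
  destruct (classic (0 < s < r)) as [Hs|Hs].
  + transitivity (circle_mean g s); apply continuous_const_interior; try (apply Hcm; lra); try lra;
      intros x y Hx Hy; apply circle_mean_const; try lra; intros z Hz; apply Hd; lra.
  + apply continuous_const_interior; try (apply Hcm; lra); try lra.
    intros x y Hx Hy; apply circle_mean_const; try lra; intros z Hz; apply Hd; lra.
- unfold circle_mean.
  rewrite (RInt_ext (fun t => Re (g (polar 0 t))) (fun _ => Re (g 0)))
    by (intros; rewrite polar_0; reflexivity).
  rewrite (RInt_ext (fun t => Im (g (polar 0 t))) (fun _ => Im (g 0)))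
    by (intros; rewrite polar_0; reflexivity).
  rewrite !RInt_const. unfold scal; simpl; unfold mult; simpl.
  destruct (g 0) as [u v]; simpl. f_equal; field; lra.
Qed.

Lemma circle_mean_ext (g h : C -> C) (r : R) :
  (forall z, Cmod z = Rabs r -> g z = h z) -> circle_mean g r = circle_mean h r.
Proof.
intros H. unfold circle_mean.
f_equal; f_equal; apply RInt_ext; intros t _; rewrite H; auto using Cmod_polar.
Qed.

Lemma ex_RInt_circle (p : C -> R) (r : R) :
  (forall z, Cmod z = Rabs r -> continuous p z) ->
  ex_RInt (fun t => p (polar r t)) 0 (2 * PI).
Proof.
intros H. apply (ex_RInt_continuous (V := R_CompleteNormedModule)); intros t _.
apply (continuous_comp (polar r) p); [|apply H, Cmod_polar].
apply (continuous_polar_angle (fun z => z)), continuous_id.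
Qed.

Lemma circle_mean_plus (g h : C -> C) (r : R) :
  (forall z, Cmod z = Rabs r -> continuous g z) ->
  (forall z, Cmod z = Rabs r -> continuous h z) ->
  circle_mean (fun z => (g z + h z)%C) r = (circle_mean g r + circle_mean h r)%C.
Proof.
intros Hg Hh. unfold circle_mean, Cplus; simpl.
rewrite <- !Rdiv_plus_distr.
f_equal; f_equal; apply (RInt_plus (V := R_CompleteNormedModule)).
- apply (ex_RInt_circle (fun z => Re (g z))); intros; apply continuous_Re; auto.
- apply (ex_RInt_circle (fun z => Re (h z))); intros; apply continuous_Re; auto.
- apply (ex_RInt_circle (fun z => Im (g z))); intros; apply continuous_Im; auto.
- apply (ex_RInt_circle (fun z => Im (h z))); intros; apply continuous_Im; auto.
Qed.

Lemma circle_mean_scal (c : C) (g : C -> C) (r : R) :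
  (forall z, Cmod z = Rabs r -> continuous g z) ->
  circle_mean (fun z => (c * g z)%C) r = (c * circle_mean g r)%C.
Proof.
intros Hg. pose proof PI_RGT_0.
assert (H1 : ex_RInt (fun t => Re (g (polar r t))) 0 (2 * PI)).
{ apply (ex_RInt_circle (fun z => Re (g z))); intros; apply continuous_Re; auto. }
assert (H2 : ex_RInt (fun t => Im (g (polar r t))) 0 (2 * PI)).
{ apply (ex_RInt_circle (fun z => Im (g z))); intros; apply continuous_Im; auto. }
assert (E : forall a b : R,
  RInt (fun t => a * Re (g (polar r t)) + b * Im (g (polar r t))) 0 (2 * PI) =
  a * RInt (fun t => Re (g (polar r t))) 0 (2 * PI)
  + b * RInt (fun t => Im (g (polar r t))) 0 (2 * PI)).
{ intros a b.
  rewrite (RInt_plus (V := R_CompleteNormedModule)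
    (fun t => a * Re (g (polar r t))) (fun t => b * Im (g (polar r t)))).
  - rewrite (RInt_scal (V := R_CompleteNormedModule) (fun t => Re (g (polar r t)))) by assumption.
    rewrite (RInt_scal (V := R_CompleteNormedModule) (fun t => Im (g (polar r t)))) by assumption.
    reflexivity.
  - apply (ex_RInt_scal (V := R_NormedModule)); assumption.
  - apply (ex_RInt_scal (V := R_NormedModule)); assumption. }
unfold circle_mean, Cmult; simpl. f_equal.
- rewrite (RInt_ext _ (fun t => Re c * Re (g (polar r t)) + (- Im c) * Im (g (polar r t))))
    by (intros; unfold Re, Im; simpl; ring).
  rewrite E. unfold Re, Im; field; lra.
- rewrite (RInt_ext _ (fun t => Im c * Re (g (polar r t)) + Re c * Im (g (polar r t))))
    by (intros; unfold Re, Im; simpl; ring).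
  rewrite E. unfold Re, Im; field; lra.
Qed.

Lemma circle_mean_conj (g : C -> C) (r : R) :
  (forall z, Cmod z = Rabs r -> continuous g z) ->
  circle_mean (fun z => Cconj (g z)) r = Cconj (circle_mean g r).
Proof.
intros Hg. pose proof PI_RGT_0. unfold circle_mean, Cconj; simpl. f_equal.
rewrite (RInt_opp (V := R_CompleteNormedModule) (fun t => Im (g (polar r t)))).
- unfold opp; simpl. field; lra.
- apply (ex_RInt_circle (fun z => Im (g z))); intros; apply continuous_Im; auto.
Qed.

Lemma circle_mean_Re_ge_0 (g : C -> C) (r : R) :
  (forall z, Cmod z = Rabs r -> continuous g z) ->
  (forall z, Cmod z = Rabs r -> 0 <= Re (g z)) -> 0 <= Re (circle_mean g r).
Proof.
intros Hg Hp. pose proof PI_RGT_0. simpl.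
apply Rdiv_le_0_compat; [|lra]. apply RInt_ge_0; [lra| |].
- apply (ex_RInt_circle (fun z => Re (g z))); intros; apply continuous_Re; auto.
- intros t _; apply Hp, Cmod_polar.
Qed.

(** Real and imaginary parts are bounded separately, which costs a factor [sqrt 2], rounded up to
    2. *)
Lemma circle_mean_bound (g : C -> C) (r M : R) :
  (forall z, Cmod z = Rabs r -> continuous g z) ->
  (forall t, 0 <= t <= 2 * PI -> Cmod (g (polar r t)) <= M) ->
  Cmod (circle_mean g r) <= 2 * M.
Proof.
intros Hg Hp. pose proof PI_RGT_0.
assert (H1 : forall p : C -> R, (forall z, Cmod z = Rabs r -> continuous p z) ->
  (forall t, 0 <= t <= 2 * PI -> Rabs (p (polar r t)) <= M) ->
  Rabs (RInt (fun t => p (polar r t)) 0 (2 * PI) / (2 * PI)) <= M).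
{ intros p Hc Hm. rewrite Rabs_div, (Rabs_pos_eq (2 * PI)) by lra.
  apply Rle_div_l; [lra|]. replace (M * (2 * PI)) with ((2 * PI - 0) * M) by ring.
  apply abs_RInt_le_const; [lra|apply ex_RInt_circle; auto|assumption]. }
assert (HM : Rmax (Rabs (fst (circle_mean g r))) (Rabs (snd (circle_mean g r))) <= M).
{ apply Rmax_lub; simpl.
  - apply (H1 (fun z => Re (g z))); intros; [apply continuous_Re; auto|].
    eapply Rle_trans; [apply re_le_Cmod|auto].
  - apply (H1 (fun z => Im (g z))); intros; [apply continuous_Im; auto|].
    eapply Rle_trans; [|apply Hp; eassumption].
    eapply Rle_trans; [apply Rmax_r|apply Rmax_Cmod]. }
eapply Rle_trans; [apply Cmod_2Rmax|].
pose proof sqrt_2_lt_2.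
assert (0 <= M).
{ eapply Rle_trans; [|exact HM]. eapply Rle_trans; [apply Rabs_pos|apply Rmax_l]. }
apply Rmult_le_compat; try lra; [apply sqrt_pos|].
eapply Rle_trans; [apply Rabs_pos|apply Rmax_l].
Qed.

Lemma circle_bounded (g : C -> C) (r : R) :
  (forall z, Cmod z = Rabs r -> continuous g z) ->
  exists M, forall t, 0 <= t <= 2 * PI -> Cmod (g (polar r t)) <= M.
Proof.
intros Hg. pose proof PI_RGT_0.
destruct (continuity_ab_maj (fun t => Re (g (polar r t)) ^ 2 + Im (g (polar r t)) ^ 2)
  0 (2 * PI)) as (t0 & Ht0 & _); [lra| |].
- intros t _. apply continuity_pt_filterlim.
  assert (Hc : continuous (fun t => g (polar r t)) t).
  { apply continuous_polar_angle, Hg, Cmod_polar. }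
  pose proof (continuous_Re _ _ Hc) as H1; pose proof (continuous_Im _ _ Hc) as H2.
  change (continuous (fun t => Re (g (polar r t)) ^ 2 + Im (g (polar r t)) ^ 2) t).
  apply (continuous_plus (V := R_NormedModule)); simpl;
    apply (continuous_mult (K := R_AbsRing)); auto;
    apply (continuous_mult (K := R_AbsRing)); auto using continuous_const.
- exists (1 + (Re (g (polar r t0)) ^ 2 + Im (g (polar r t0)) ^ 2)). intros t Ht.
  specialize (Ht0 t Ht); rewrite <- !Cmod2_alt in *.
  nra.
Qed.

Lemma Cneq_Cmod (z w : C) : Cmod w < Cmod z -> (z - w)%C <> 0.
Proof. intros H E. apply Ceq_minus in E. subst; lra. Qed.

Lemma Cneq0_Cmod (z : C) : 0 < Cmod z -> z <> 0.
Proof. apply Cmod_gt_0. Qed.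

Lemma Cconj_mult_self (z : C) : (Cconj z * z)%C = RtoC (Cmod z ^ 2).
Proof. rewrite Cmod2_conj; apply Cmult_comm. Qed.

Lemma Csub_mult_neq_0 (s : R) (a z : C) :
  Cmod a * Cmod z < s -> (RtoC s - Cconj a * z)%C <> 0.
Proof.
intros H. apply Cneq_Cmod. rewrite Cmod_mult, Cmod_conj, Cmod_R.
eapply Rlt_le_trans; [exact H|apply Rle_abs].
Qed.

(* On [|z| = r] the function [z / (z - a)] is the conjugate of
   [r^2 / (r^2 - conj a * z)], which is holomorphic inside. *)
Lemma circle_mean_kernel (a : C) (r : R) :
  Cmod a < r -> circle_mean (fun z => (z / (z - a))%C) r = 1.
Proof.
intros Ha. pose proof (Cmod_ge_0 a) as H0.
pose (h := fun z => (RtoC (r ^ 2) / (RtoC (r ^ 2) - Cconj a * z))%C).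
(* The radius [2 r^2 / (|a| + r)] exceeds [r] but stays below [r^2 / |a|], the modulus of the pole
   of [h], and it makes sense for [a = 0] as well. *)
assert (Hn : forall z, Cmod z < r * (r / (Cmod a + r) * 2) ->
  (RtoC (r ^ 2) - Cconj a * z)%C <> 0).
{ intros z Hz. apply Csub_mult_neq_0.
  apply Rle_lt_trans with (Cmod a * (r * (r / (Cmod a + r) * 2))).
  - apply Rmult_le_compat_l; lra.
  - replace (Cmod a * (r * (r / (Cmod a + r) * 2)))
      with (r ^ 2 * (2 * Cmod a / (Cmod a + r))) by (field; lra).
    rewrite <- (Rmult_1_r (r ^ 2)) at 2. apply Rmult_lt_compat_l; [apply pow_lt; lra|].
    apply Rlt_div_l; lra. }
assert (HR : r < r * (r / (Cmod a + r) * 2)).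
{ rewrite <- (Rmult_1_r r) at 1. apply Rmult_lt_compat_l; [lra|].
  replace (r / (Cmod a + r) * 2) with (2 * r / (Cmod a + r)) by (field; lra).
  apply Rlt_div_r; lra. }
assert (Hd : forall z, Cmod z < r * (r / (Cmod a + r) * 2) -> ex_Cderive h z).
{ intros z Hz. unfold h; Cderiv. auto. }
rewrite (circle_mean_ext _ (fun z => Cconj (h z))).
- rewrite circle_mean_conj.
  + rewrite (mean_value_property h (r * (r / (Cmod a + r) * 2)) 0 r); try lra.
    * unfold h. rewrite Cmult_0_r. replace (RtoC (r ^ 2) / (RtoC (r ^ 2) - 0))%C with (RtoC 1).
      -- apply Cconj_RtoC.
      -- field. apply Cneq0_Cmod. rewrite Cmod_R, Rabs_pos_eq; [apply pow_lt; lra|apply pow_le; lra].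
    * intros; apply ex_Cderive_continuous; auto.
    * intros; apply Hd; lra.
  + intros z Hz. rewrite Rabs_pos_eq in Hz by lra. apply ex_Cderive_continuous, Hd. lra.
- intros z Hz. rewrite Rabs_pos_eq in Hz by lra.
  assert (Hz0 : z <> 0) by (apply Cneq0_Cmod; lra).
  assert (Hza : (z - a)%C <> 0) by (apply Cneq_Cmod; lra).
  unfold h. rewrite Cdiv_conj by (apply Hn; lra).
  rewrite Cminus_conj, Cmult_conj, Cconj_conj.
  rewrite Cconj_RtoC.
  rewrite <- Hz, <- Cconj_mult_self.
  assert (Hcz : Cconj z <> 0) by (apply Cneq0_Cmod; rewrite Cmod_conj; lra).
  field. repeat split; try assumption.
  replace (Cconj z * z - a * Cconj z)%C with (Cconj z * (z - a))%C by ring.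
  apply Cmult_neq_0; assumption.
Qed.

(* The point 0 is allowed to be an exceptional point in view of the removable
   singularity theorem below. *)
Lemma cauchy_formula (g : C -> C) (a : C) (r R0 : R) :
  Cmod a < r < R0 -> (forall z, Cmod z < R0 -> continuous g z) ->
  (forall z, 0 < Cmod z < R0 -> ex_Cderive g z) ->
  circle_mean (fun z => (g z * (z / (z - a)))%C) r = g a.
Proof.
intros Ha Hc Hd. pose proof (Cmod_ge_0 a) as H0.
assert (Hza : forall z, Cmod z = Rabs r -> (z - a)%C <> 0).
{ intros z Hz. rewrite Rabs_pos_eq in Hz by lra. apply Cneq_Cmod; lra. }
(* At the possibly exceptional point 0 no slope function is available, but there the kernel is 1 and
   the mean value property suffices. *)
destruct (Ceq_dec a 0) as [->|Hn].
{ rewrite (circle_mean_ext _ g).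
  - apply (mean_value_property g R0 0 r); try lra; auto.
  - intros z Hz. field. generalize (Hza z Hz). intros H E; apply H; rewrite E; ring. }
destruct (Hd a) as [l Hl].
{ split; [apply Cmod_gt_0; assumption|lra]. }
apply is_Cderive_slope in Hl. destruct Hl as (phi & Cphi & _ & Hphi).
(* The factor [z] makes [psi] vanish at 0, so its mean is 0; this turns the formula into the mean of
   the kernel alone. The circle through [a] is the exceptional one. *)
pose (psi := fun z => if Ceq_dec z a then (z * phi a)%C else (z * ((g z - g a) / (z - a)))%C).
assert (Hmean : circle_mean psi r = 0).
{ rewrite (mean_value_property psi R0 (Cmod a) r); try lra.
  - unfold psi. destruct (Ceq_dec 0 a); ring.
  - intros z Hz. destruct (Ceq_dec z a) as [->|Hza'].
    + apply (continuous_ext_loc _ (fun w => (w * phi w)%C)); [|Ccont].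
      generalize Hphi; apply filter_imp. intros w Hw; unfold psi.
      destruct (Ceq_dec w a) as [->|Hwa]; [reflexivity|]. rewrite Hw. Ceq. field.
      intros E; apply Hwa, Ceq_minus, E.
    + apply (continuous_ext_loc _ (fun w => (w * ((g w - g a) / (w - a)))%C)).
      * generalize (locally_neq z a Hza'); apply filter_imp; intros w Hw; unfold psi.
        destruct (Ceq_dec w a); [contradiction|reflexivity].
      * Ccont; [auto|]. intros E; apply Hza', Ceq_minus, E.
  - intros z Hz Hzs.
    assert (Hza' : z <> a) by (intros ->; auto).
    apply (ex_Cderive_ext_loc (fun w => (w * ((g w - g a) / (w - a)))%C)).
    + generalize (locally_neq z a Hza'); apply filter_imp; intros w Hw; unfold psi.
      destruct (Ceq_dec w a); [contradiction|reflexivity].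
    + Cderiv; [auto|]. intros E; apply Hza', Ceq_minus, E. }
rewrite (circle_mean_ext _ (fun z => psi z + g a * (z / (z - a)))%C).
- rewrite circle_mean_plus, circle_mean_scal, Hmean, circle_mean_kernel; [ring|lra| | |].
  + intros z Hz; Ccont; auto.
  + intros z Hz. apply (continuous_ext_loc _ (fun w => (w * ((g w - g a) / (w - a)))%C)).
    * assert (Hza' : z <> a) by (intros ->; apply (Hza a Hz); ring).
      generalize (locally_neq z a Hza'); apply filter_imp; intros w Hw; unfold psi.
      destruct (Ceq_dec w a); [contradiction|reflexivity].
    * Ccont; auto. apply Hc. rewrite Hz, Rabs_pos_eq; lra.
  + intros z Hz; Ccont; auto.
- intros z Hz. unfold psi. destruct (Ceq_dec z a) as [->|_].
  + exfalso; apply (Hza a Hz); ring.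
  + field; auto.
Qed.

(** Expanding [z/(z - a) = 1 + a/z + a^2/(z (z - a))] in Cauchy's formula for [g a] exhibits the
    derivative at 0 as the mean of [g z / z], with a remainder of order [a^2]. *)
Lemma removable_singularity (g : C -> C) (R0 : R) :
  0 < R0 -> (forall z, Cmod z < R0 -> continuous g z) ->
  (forall z, 0 < Cmod z < R0 -> ex_Cderive g z) -> ex_Cderive g (RtoC 0).
Proof.
intros HR Hc Hd. set (r := R0 / 2). assert (Hr : 0 < r < R0) by (unfold r; lra).
assert (Ar : Rabs r = r) by (apply Rabs_pos_eq; lra).
assert (Hcr : forall z, Cmod z = Rabs r -> continuous g z) by (intros z Hz; apply Hc; lra).
destruct (circle_bounded g r Hcr) as [M HM].
assert (HM0 : 0 <= M).
{ eapply Rle_trans; [apply Cmod_ge_0|apply (HM 0)]. generalize PI_RGT_0; lra. }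
exists (circle_mean (fun z => (g z / z)%C) r). apply is_Cderive_eps. intros eps.
(* For [|a| < r/2] one has [|z - a| >= r/2] on the circle; the leading 2 is that of
   [circle_mean_bound]. *)
set (K := 2 * (M / (r * (r / 2)))).
assert (HK : 0 <= K).
{ unfold K. apply Rmult_le_pos; [lra|]. apply Rdiv_le_0_compat; [lra|]. apply Rmult_lt_0_compat; lra. }
assert (Hdel : 0 < Rmin (r / 2) (eps / (K + 1))).
{ apply Rmin_pos; [lra|]. apply Rdiv_lt_0_compat; [apply cond_pos|lra]. }
apply locally_C_Cmod. exists (mkposreal _ Hdel); simpl. intros a Ha.
replace (a - 0)%C with a in * by ring.
assert (Ha1 : Cmod a < r / 2) by (eapply Rlt_le_trans; [exact Ha|apply Rmin_l]).
assert (Ha2 : Cmod a < eps / (K + 1)) by (eapply Rlt_le_trans; [exact Ha|apply Rmin_r]).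
assert (Hza : forall z, Cmod z = Rabs r -> (z - a)%C <> 0).
{ intros z Hz. apply Cneq_Cmod; lra. }
assert (Hz0 : forall z, Cmod z = Rabs r -> z <> 0).
{ intros z Hz. apply Cneq0_Cmod; lra. }
pose (k := fun z => (g z / (z * (z - a)))%C).
assert (Ck : forall z, Cmod z = Rabs r -> continuous k z).
{ intros z Hz; unfold k. Ccont; auto. apply Cmult_neq_0; auto. }
assert (E : (g a - g 0 - circle_mean (fun z => (g z / z)%C) r * a)%C =
  (a * a * circle_mean k r)%C).
{ rewrite <- (cauchy_formula g a r R0) by (auto; lra).
  rewrite <- (cauchy_formula g 0 r R0) by (auto; rewrite ?Cmod_0; lra).
  rewrite (circle_mean_ext (fun z => (g z * (z / (z - a)))%C)
    (fun z => (g z * (z / (z - 0)) + (a * (g z / z) + a * a * k z))%C)).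
  - rewrite circle_mean_plus, circle_mean_plus, !circle_mean_scal; [ring|..];
      intros z Hz; unfold k; Ccont; auto; try apply Cmult_neq_0; auto.
    intros E; apply (Hz0 z Hz). rewrite <- E; ring.
  - intros z Hz; unfold k. field. repeat split; auto. }
rewrite E, !Cmod_mult.
assert (Hkb : Cmod (circle_mean k r) <= K).
{ apply circle_mean_bound; [assumption|]. intros t Ht. unfold k.
  assert (Hp : Cmod (polar r t) = Rabs r) by apply Cmod_polar.
  rewrite Cmod_div, Cmod_mult by (apply Cmult_neq_0; auto). rewrite Hp, Ar.
  assert (Hl : r / 2 <= Cmod (polar r t - a)).
  { assert (Htr := Cmod_triangle (polar r t - a) a).
    replace (polar r t - a + a)%C with (polar r t) in Htr by ring. lra. }
  apply Rmult_le_compat; auto.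
  - apply Cmod_ge_0.
  - left; apply Rinv_0_lt_compat, Rmult_lt_0_compat; lra.
  - apply Rinv_le_contravar; [apply Rmult_lt_0_compat; lra|apply Rmult_le_compat_l; lra]. }
pose proof (Cmod_ge_0 a). pose proof (Cmod_ge_0 (circle_mean k r)).
assert (Cmod a * (K + 1) <= eps).
{ apply Rlt_div_r in Ha2; lra. }
assert (Cmod a * Cmod (circle_mean k r) <= eps) by nra.
nra.
Qed.

(** * The Schwarz-Pick inequality in the right half-plane *)

Lemma continuous_left_nonneg (f : R -> R) (a b : R) :
  a < b -> continuous f b -> (forall s, a < s < b -> 0 <= f s) -> 0 <= f b.
Proof.
intros Hab Hc Hp. apply Rnot_lt_le; intros Hn.
assert (He : 0 < - f b) by lra.
destruct (proj1 (filterlim_locally _ _) Hc (mkposreal _ He)) as [d Hd].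
set (s := Rmax ((a + b) / 2) (b - d / 2)).
assert (H1 : (a + b) / 2 <= s) by apply Rmax_l.
assert (H2 : b - d / 2 <= s) by apply Rmax_r.
generalize (cond_pos d); intros H4.
assert (H3 : s < b) by (apply Rmax_lub_lt; lra).
assert (Hb : Rabs (f s - f b) < - f b).
{ apply (Hd s). apply Rabs_def1; simpl; unfold minus, plus, opp; simpl; lra. }
specialize (Hp s ltac:(lra)). apply Rabs_lt_between in Hb. lra.
Qed.

Lemma Re_div_conj (c d : C) : d <> 0 -> Re (c / d) = Re (Cconj c / Cconj d)%C.
Proof. intros H. rewrite <- Cdiv_conj by assumption. symmetry; apply re_conj. Qed.

(* Cauchy's formula for [q * m], where [m] is holomorphic and [z * m z] is the
   conjugate of [1/(z - a) + lam/(z - b)] on the circle [|z|^2 = s], evaluates the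
   mean of [q * |1/(z - a) + lam/(z - b)|^2] over that circle. *)
Lemma pick_form_circle (q : C -> C) (a b lam : C) (s : R) :
  holomorphic_on_disk q -> (forall z, in_disk z -> 0 <= Re (q z)) ->
  Cmod a < s -> Cmod b < s -> s < 1 ->
  let m z := (1 / (RtoC s - Cconj a * z) + Cconj lam / (RtoC s - Cconj b * z))%C in
  0 <= Re (q a * m a + lam * (q b * m b)).
Proof.
intros Hq Hp Ha Hb Hs m. unfold in_disk in *.
pose proof (Cmod_ge_0 a) as Ha0; pose proof (Cmod_ge_0 b) as Hb0.
(* Taking the squared radius [s] as parameter keeps the square root out of [m], so that the later
   limit [s -> 1] concerns rational expressions only. *)
set (r := sqrt s).
assert (Hr0 : 0 < r) by (apply sqrt_lt_R0; lra).
assert (Hrs : r ^ 2 = s) by (apply pow2_sqrt; lra).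
assert (Hr : s < r < 1) by nra.
assert (Ar : Rabs r = r) by (apply Rabs_pos_eq; lra).
assert (Hna : forall z, Cmod z < 1 -> (RtoC s - Cconj a * z)%C <> 0).
{ intros z Hz. pose proof (Cmod_ge_0 z). apply Csub_mult_neq_0. nra. }
assert (Hnb : forall z, Cmod z < 1 -> (RtoC s - Cconj b * z)%C <> 0).
{ intros z Hz. pose proof (Cmod_ge_0 z). apply Csub_mult_neq_0. nra. }
assert (Hm : forall z, Cmod z < 1 -> ex_Cderive (fun z => (q z * m z)%C) z).
{ intros z Hz. unfold m. assert (Hqz := Hq z Hz). Cderiv; auto. }
assert (Cm : forall z, Cmod z < 1 -> continuous (fun z => (q z * m z)%C) z).
{ intros; apply ex_Cderive_continuous; auto. }
assert (Hza : forall z, Cmod z = Rabs r -> (z - a)%C <> 0).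
{ intros z Hz. apply Cneq_Cmod; lra. }
assert (Hzb : forall z, Cmod z = Rabs r -> (z - b)%C <> 0).
{ intros z Hz. apply Cneq_Cmod; lra. }
assert (C1 : forall z, Cmod z = Rabs r -> continuous (fun z => (q z * m z * (z / (z - a)))%C) z).
{ intros z Hz. assert (Hc := Cm z ltac:(lra)).
  apply (continuous_Cmult (fun z => q z * m z)%C (fun z => z / (z - a))%C); [assumption|].
  Ccont; auto. }
assert (C2 : forall z, Cmod z = Rabs r -> continuous (fun z => (q z * m z * (z / (z - b)))%C) z).
{ intros z Hz. assert (Hc := Cm z ltac:(lra)).
  apply (continuous_Cmult (fun z => q z * m z)%C (fun z => z / (z - b))%C); [assumption|].
  Ccont; auto. }
assert (C3 : forall z, Cmod z = Rabs r ->
  continuous (fun z => (lam * (q z * m z * (z / (z - b))))%C) z).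
{ intros z Hz. assert (Hc := C2 z Hz).
  apply (continuous_Cmult (fun z => lam)%C (fun z => q z * m z * (z / (z - b)))%C); [|assumption].
  apply continuous_const. }
rewrite <- (cauchy_formula (fun z => (q z * m z)%C) a r 1); [|lra|assumption|intros; apply Hm; lra].
rewrite <- (cauchy_formula (fun z => (q z * m z)%C) b r 1); [|lra|assumption|intros; apply Hm; lra].
rewrite <- circle_mean_scal by assumption.
rewrite <- circle_mean_plus by assumption.
apply circle_mean_Re_ge_0.
- intros z Hz. apply (continuous_Cplus (fun z => q z * m z * (z / (z - a)))%C); auto.
- intros z Hz.
  set (k := (1 / (z - a) + lam / (z - b))%C).
  assert (E : (q z * m z * (z / (z - a)) + lam * (q z * m z * (z / (z - b))))%C =
    (RtoC (Cmod k ^ 2) * q z)%C).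
  { rewrite Cmod2_conj.
    replace (Cconj k) with (z * m z)%C.
    - unfold k. field. split; auto.
    - unfold k, m.
      assert (Hz1 : Cmod z < 1) by lra.
      pose proof (Hna z Hz1) as N1; pose proof (Hnb z Hz1) as N2.
      rewrite <- Hrs, <- Ar, <- Hz, <- Cconj_mult_self in N1, N2 |- *.
      rewrite Cplus_conj, !Cdiv_conj, !Cminus_conj by auto.
      rewrite Cconj_RtoC.
      assert (M1 : (Cconj z - Cconj a)%C <> 0).
      { rewrite <- Cminus_conj. apply Cneq0_Cmod. rewrite Cmod_conj. apply Cmod_gt_0; auto. }
      assert (M2 : (Cconj z - Cconj b)%C <> 0).
      { rewrite <- Cminus_conj. apply Cneq0_Cmod. rewrite Cmod_conj. apply Cmod_gt_0; auto. }
      field. repeat split; auto. }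
  rewrite E, re_scal_l. apply Rmult_le_pos; [apply pow2_ge_0|]. apply Hp; unfold in_disk; lra.
Qed.

(** Half the Hermitian form of the Pick matrix of [q] at the points [a] and [b], with coefficients 1
    and [lam]; it is the limit [s -> 1] of [pick_form_circle]. *)
Lemma pick_form (q : C -> C) (a b lam : C) :
  holomorphic_on_disk q -> (forall z, in_disk z -> 0 <= Re (q z)) ->
  in_disk a -> in_disk b ->
  0 <= Re (q a) / (1 - Cmod a ^ 2)
       + Re (Cconj lam * ((q a + Cconj (q b)) / (1 - Cconj b * a)))
       + Cmod lam ^ 2 * (Re (q b) / (1 - Cmod b ^ 2)).
Proof.
intros Hq Hp Ha Hb. unfold in_disk in *.
pose proof (Cmod_ge_0 a) as Ha0; pose proof (Cmod_ge_0 b) as Hb0.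
assert (Hn : forall u v, Cmod u < 1 -> Cmod v < 1 -> (RtoC 1 - Cconj u * v)%C <> 0).
{ intros u v Hu Hv. apply Csub_mult_neq_0. pose proof (Cmod_ge_0 u); pose proof (Cmod_ge_0 v). nra. }
pose (G := fun s : R =>
  (q a * (1 / (RtoC s - Cconj a * a) + Cconj lam / (RtoC s - Cconj b * a)) +
   lam * (q b * (1 / (RtoC s - Cconj a * b) + Cconj lam / (RtoC s - Cconj b * b))))%C).
assert (HG : 0 <= Re (G 1)).
{ apply (continuous_left_nonneg (fun s => Re (G s)) (Rmax (Cmod a) (Cmod b))).
  - apply Rmax_lub_lt; assumption.
  - apply continuous_Re. unfold G.
    assert (Hs := continuous_RtoC 1).
    Ccont; auto.
  - intros s [Hs1 Hs2].
    apply (pick_form_circle q a b lam s); auto.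
    + eapply Rle_lt_trans; [apply Rmax_l|exact Hs1].
    + eapply Rle_lt_trans; [apply Rmax_r|exact Hs1]. }
replace (Re (q a) / (1 - Cmod a ^ 2)
       + Re (Cconj lam * ((q a + Cconj (q b)) / (1 - Cconj b * a)))
       + Cmod lam ^ 2 * (Re (q b) / (1 - Cmod b ^ 2))) with (Re (G 1)); [assumption|].
unfold G. rewrite !Cconj_mult_self, <- !RtoC_minus.
assert (N1 : 1 - Cmod a ^ 2 <> 0) by nra.
assert (N2 : 1 - Cmod b ^ 2 <> 0) by nra.
replace (q a * (1 / RtoC (1 - Cmod a ^ 2) + Cconj lam / (1 - Cconj b * a)) +
   lam * (q b * (1 / (1 - Cconj a * b) + Cconj lam / RtoC (1 - Cmod b ^ 2))))%C
  with (RtoC (/ (1 - Cmod a ^ 2)) * q a + Cconj lam * q a / (1 - Cconj b * a)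
    + (lam * q b / (1 - Cconj a * b) + RtoC (Cmod lam ^ 2 * / (1 - Cmod b ^ 2)) * q b))%C.
- rewrite !re_plus, !re_scal_l.
  (* One of the two cross terms is conjugated, which leaves its real part unchanged and gives it the
     denominator of the other. *)
  rewrite (Re_div_conj (lam * q b)) by auto.
  rewrite Cminus_conj, !Cmult_conj, Cconj_conj.
  rewrite Cconj_RtoC.
  replace (Cconj lam * ((q a + Cconj (q b)) / (1 - Cconj b * a)))%C
    with (Cconj lam * q a / (1 - Cconj b * a) + Cconj lam * Cconj (q b) / (1 - a * Cconj b))%C.
  + rewrite re_plus. unfold Rdiv; ring.
  + rewrite (Cmult_comm a). field. auto.
- rewrite RtoC_mult, !RtoC_inv by assumption. rewrite Cmod2_conj.
  field. repeat split; auto; intros E; [apply N2|apply N1]; apply RtoC_inj; exact E.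
Qed.

(** The determinant condition for the form of [pick_form]. It is equivalent to the usual inequality
    for [|q a - q b|], since [|q a + conj (q b)|^2 = |q a - q b|^2 + 4 Re (q a) Re (q b)] and [|1 -
    conj b a|^2 = |a - b|^2 + (1 - |a|^2)(1 - |b|^2)]. *)
Lemma schwarz_pick (q : C -> C) (a b : C) :
  holomorphic_on_disk q -> (forall z, in_disk z -> 0 <= Re (q z)) ->
  in_disk a -> in_disk b ->
  Cmod (q a + Cconj (q b)) ^ 2 * ((1 - Cmod a ^ 2) * (1 - Cmod b ^ 2))
  <= 4 * Cmod (1 - Cconj b * a) ^ 2 * (Re (q a) * Re (q b)).
Proof.
intros Hq Hp Ha Hb.
pose proof (Cmod_ge_0 a) as Ha0; pose proof (Cmod_ge_0 b) as Hb0.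
assert (N1 : 0 < 1 - Cmod a ^ 2) by (unfold in_disk in *; nra).
assert (N2 : 0 < 1 - Cmod b ^ 2) by (unfold in_disk in *; nra).
assert (N : (1 - Cconj b * a)%C <> 0).
{ apply Csub_mult_neq_0. unfold in_disk in *; nra. }
set (B := ((q a + Cconj (q b)) / (1 - Cconj b * a))%C).
set (A := Re (q a) / (1 - Cmod a ^ 2)). set (D := Re (q b) / (1 - Cmod b ^ 2)).
assert (HA : 0 <= A) by (apply Rdiv_le_0_compat; auto).
assert (HD : 0 <= D) by (apply Rdiv_le_0_compat; auto).
(* The choice [lam = - t B] turns the cross term into [- t |B|^2]. *)
assert (Hform : forall t : R, 0 <= A - t * Cmod B ^ 2 + t ^ 2 * Cmod B ^ 2 * D).
{ intros t. pose proof (pick_form q a b (RtoC (- t) * B)%C Hq Hp Ha Hb) as H.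
  fold A D B in H. rewrite Cmult_conj, Cmod_mult, Cmod_R in H.
  rewrite Cconj_RtoC in H.
  rewrite <- Cmult_assoc, Cconj_mult_self, re_scal_l, re_RtoC, Rpow_mult_distr in H.
  rewrite pow2_abs in H. nra. }
assert (HB : Cmod B ^ 2 <= 4 * (A * D)).
{ pose proof (pow2_ge_0 (Cmod B)) as HB0.
  destruct HD as [HD|HD].
  (* This [t] minimizes the quadratic polynomial. *)
  - specialize (Hform (/ (2 * D))).
    replace (A - / (2 * D) * Cmod B ^ 2 + (/ (2 * D)) ^ 2 * Cmod B ^ 2 * D)
      with ((4 * (A * D) - Cmod B ^ 2) * / (4 * D)) in Hform by (field; lra).
    apply Rnot_lt_le; intros Hn.
    assert (0 < / (4 * D)) by (apply Rinv_0_lt_compat; lra). nra.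
  - rewrite <- HD in *. destruct (Req_dec (Cmod B ^ 2) 0) as [E|E]; [rewrite E; lra|].
    (* For [D = 0] the expression is affine in [t], and this [t] would give it the value -1, so [B]
       must vanish. *)
    specialize (Hform ((A + 1) / Cmod B ^ 2)).
    replace (A - (A + 1) / Cmod B ^ 2 * Cmod B ^ 2 +
      ((A + 1) / Cmod B ^ 2) ^ 2 * Cmod B ^ 2 * 0) with (- (1)) in Hform by (field; intros E2; apply E; rewrite E2; ring).
    lra. }
assert (EB : Cmod (q a + Cconj (q b)) = Cmod B * Cmod (1 - Cconj b * a)).
{ rewrite <- Cmod_mult. f_equal. unfold B. field. assumption. }
rewrite EB.
apply Rle_trans with (4 * (A * D) * (Cmod (1 - Cconj b * a) ^ 2 * ((1 - Cmod a ^ 2) * (1 - Cmod b ^ 2)))).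
- replace ((Cmod B * Cmod (1 - Cconj b * a)) ^ 2 * ((1 - Cmod a ^ 2) * (1 - Cmod b ^ 2)))
    with (Cmod B ^ 2 * (Cmod (1 - Cconj b * a) ^ 2 * ((1 - Cmod a ^ 2) * (1 - Cmod b ^ 2)))) by ring.
  apply Rmult_le_compat_r; [|assumption].
  apply Rmult_le_pos; [apply pow2_ge_0|apply Rmult_le_pos; lra].
- right. unfold A, D. field. lra.
Qed.

(** Used for [w = 1], where it gives the positivity of the Cayley transform of a self-map, and for
    [|w| = 1], where it is the Poisson kernel. *)
Lemma Re_cayley (z w : C) : (w - z)%C <> 0 ->
  Re ((w + z) / (w - z)) = (Cmod w ^ 2 - Cmod z ^ 2) / Cmod (w - z) ^ 2.
Proof.
intros H.
assert (Hm : Cmod (w - z) ^ 2 <> 0) by (apply pow_nonzero, Rgt_not_eq, Cmod_gt_0, H).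
rewrite !Cmod2_alt in *. destruct w as [a b], z as [c d]; simpl in *.
unfold Re, Im in *; simpl in *. field. intros E; apply Hm; rewrite <- E; ring.
Qed.

(** The Cayley transform [(1 + F)/(1 - F)] has nonnegative real part and equals 1 at 0. Its
    Schwarz-Pick inequality between [z] and 0 reduces to [1 - |z|^2 <= 1 - |F z|^2]. *)
Lemma schwarz_lemma (F : C -> C) :
  holomorphic_on_disk F -> (forall z, in_disk z -> in_disk (F z)) -> F 0 = 0 ->
  forall z, in_disk z -> Cmod (F z) <= Cmod z.
Proof.
intros HF Hs H0 z Hz.
assert (Hn : forall w, in_disk w -> (1 - F w)%C <> 0).
{ intros w Hw. apply Cneq_Cmod. rewrite Cmod_1. apply Hs, Hw. }
pose (q := fun w => ((1 + F w) / (1 - F w))%C).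
assert (Hq : holomorphic_on_disk q).
{ intros w Hw; unfold q. assert (Hw' := HF w Hw). Cderiv. auto. }
assert (Hre : forall w, in_disk w -> Re (q w) = (1 - Cmod (F w) ^ 2) / Cmod (1 - F w) ^ 2).
{ intros w Hw; unfold q. rewrite Re_cayley, Cmod_1, pow1 by auto. reflexivity. }
assert (Hpos : forall w, in_disk w -> 0 < Cmod (1 - F w) ^ 2).
{ intros w Hw. apply pow_lt, Cmod_gt_0; auto. }
assert (Hp : forall w, in_disk w -> 0 <= Re (q w)).
{ intros w Hw. rewrite Hre by assumption. apply Rdiv_le_0_compat; [|auto].
  generalize (Cmod_ge_0 (F w)) (Hs w Hw); unfold in_disk; nra. }
assert (H0d : in_disk 0) by (unfold in_disk; rewrite Cmod_0; lra).
assert (Q0 : q 0 = 1).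
{ unfold q; rewrite H0. replace (1 - 0)%C with (RtoC 1) by ring. field. }
pose proof (schwarz_pick q z 0 Hq Hp Hz H0d) as H.
rewrite Q0, Cmod_0, Hre in H by assumption.
rewrite Cconj_RtoC in H.
replace (1 - Cconj 0 * z)%C with (RtoC 1) in H
  by (rewrite Cconj_RtoC; ring).
rewrite Cmod_1, re_RtoC in H.
assert (E : (q z + 1)%C = (2 / (1 - F z))%C) by (unfold q; field; auto).
rewrite E, Cmod_div, Cmod_R, Rabs_pos_eq in H by (auto; lra).
pose proof (Hpos z Hz) as Hpz.
assert (1 - Cmod z ^ 2 <= 1 - Cmod (F z) ^ 2).
{ apply Rmult_le_reg_l with (4 / Cmod (1 - F z) ^ 2); [apply Rdiv_lt_0_compat; lra|].
  replace (4 / Cmod (1 - F z) ^ 2 * (1 - Cmod z ^ 2)) with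
    ((2 / Cmod (1 - F z)) ^ 2 * ((1 - Cmod z ^ 2) * (1 - 0 ^ 2)))
    by (field; intros E2; rewrite E2 in Hpz; simpl in Hpz; lra).
  eapply Rle_trans; [exact H|]. right; field.
  intros E2; rewrite E2 in Hpz; simpl in Hpz; lra. }
generalize (Cmod_ge_0 z) (Cmod_ge_0 (F z)); nra.
Qed.

(** * Generators with Denjoy-Wolff point 0 *)

(** Semigroup orbits come with right derivatives only, so instead of the mean value theorem a
    supremum argument propagates [|u x - u 0| <= eps x]: continuity carries it to the supremum, the
    right derivative beyond it. *)
Lemma right_derivative_0_const (u : R -> C) :
  (forall t0, 0 <= t0 ->
     filterlim u (within (fun t => 0 <= t) (locally t0)) (locally (u t0))) ->
  (forall t (eps : posreal), 0 <= t -> exists d, 0 < d /\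
     forall s, 0 < s < d -> Cmod (u (t + s) - u t) <= eps * s) ->
  forall T, 0 <= T -> u T = u 0.
Proof.
intros Hc Hd T HT.
assert (H : forall eps : posreal, Cmod (u T - u 0) <= eps * T).
{ intros eps.
  pose (S := fun t => 0 <= t <= T /\ forall x, 0 <= x <= t -> Cmod (u x - u 0) <= eps * x).
  assert (S0 : S 0).
  { split; [lra|]. intros x Hx. replace x with 0 by lra.
    replace (u 0 - u 0)%C with (RtoC 0) by ring. rewrite Cmod_0; lra. }
  destruct (completeness S) as [m [Hm1 Hm2]].
  { exists T; intros x [Hx _]; lra. }
  { exists 0; exact S0. }
  assert (Hm : 0 <= m <= T).
  { split; [apply Hm1, S0|apply Hm2; intros x [Hx _]; lra]. }
  assert (Hlt : forall x, 0 <= x < m -> Cmod (u x - u 0) <= eps * x).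
  { intros x Hx. apply NNPP; intros Hn.
    assert (m <= x); [|lra]. apply Hm2. intros y [Hy1 Hy2].
    apply Rnot_lt_le; intros Hxy. apply Hn, Hy2; lra. }
  assert (HSm : Cmod (u m - u 0) <= eps * m).
  { destruct (proj1 Hm) as [Hm0|<-]; [|apply S0; lra].
    apply Rnot_lt_le; intros Hn.
    assert (Hl : locally (u m) (fun w => Cmod (w - u m) < Cmod (u m - u 0) - eps * m)).
    { apply locally_C_Cmod. assert (Hp : 0 < Cmod (u m - u 0) - eps * m) by lra.
      exists (mkposreal _ Hp); auto. }
    destruct (Hc m (proj1 Hm) _ Hl) as [d Hd'].
    set (x := Rmax (m / 2) (m - d / 2)).
    assert (X1 : m / 2 <= x) by apply Rmax_l.
    assert (X2 : m - d / 2 <= x) by apply Rmax_r.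
    generalize (cond_pos d); intros Hdp.
    assert (X3 : x < m) by (apply Rmax_lub_lt; lra).
    assert (Hx : Cmod (u x - u m) < Cmod (u m - u 0) - eps * m).
    { apply Hd'; [|lra]. change (Rabs (x - m) < d). apply Rabs_def1; lra. }
    specialize (Hlt x ltac:(lra)).
    assert (Ht := Cmod_triangle (u m - u x) (u x - u 0)).
    replace (u m - u x + (u x - u 0))%C with (u m - u 0)%C in Ht by ring.
    replace (u m - u x)%C with (- (u x - u m))%C in Ht by ring.
    rewrite Cmod_opp in Ht. generalize (cond_pos eps); nra. }
  destruct (proj2 Hm) as [HmT| <-]; [|assumption]. exfalso.
  destruct (Hd m eps (proj1 Hm)) as (d & Hdp & Hd').
  set (y := m + Rmin (d / 2) (T - m)).
  assert (Y0 : 0 < Rmin (d / 2) (T - m)) by (apply Rmin_pos; lra).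
  assert (Y1 : Rmin (d / 2) (T - m) <= d / 2) by apply Rmin_l.
  assert (Y2 : Rmin (d / 2) (T - m) <= T - m) by apply Rmin_r.
  assert (y <= m); [|unfold y in *; lra].
  apply Hm1. split; [unfold y; lra|]. intros x Hx.
  destruct (Rle_dec x m) as [Hxm|Hxm].
  - destruct Hxm as [Hxm| ->]; [apply Hlt; lra|assumption].
  - specialize (Hd' (x - m) ltac:(unfold y in *; lra)).
    replace (m + (x - m)) with x in Hd' by ring.
    assert (Ht := Cmod_triangle (u x - u m) (u m - u 0)).
    replace (u x - u m + (u m - u 0))%C with (u x - u 0)%C in Ht by ring. lra. }
apply Ceq_minus, Cmod_eq_0.
destruct (Cmod_ge_0 (u T - u 0)) as [Hp|]; [exfalso|auto].
assert (He : 0 < Cmod (u T - u 0) / (2 * (T + 1))) by (apply Rdiv_lt_0_compat; lra).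
specialize (H (mkposreal _ He)); simpl in H.
replace (Cmod (u T - u 0) / (2 * (T + 1)) * T)
  with (Cmod (u T - u 0) * (T / (2 * (T + 1)))) in H by (field; lra).
assert (T / (2 * (T + 1)) < 1) by (apply Rlt_div_l; lra). nra.
Qed.

Lemma in_disk_0 : in_disk 0.
Proof. unfold in_disk; rewrite Cmod_0; lra. Qed.

(** As [s] grows, [F t (F s 0) = F (s + t) 0] tends to [F t 0] by continuity of [F t], and to 0
    because it follows an orbit. *)
Lemma semigroup_fixes_0 (F : R -> C -> C) :
  is_semigroup F -> is_denjoy_wolff_point F 0 -> forall t, 0 <= t -> F t 0 = 0.
Proof.
intros HF [_ Hdw] t Ht.
assert (H1 : filterlim (fun s => F t (F s 0)) (Rbar_locally p_infty) (locally (F t 0))).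
{ apply (filterlim_comp _ _ _ (fun s => F s 0) (F t) _ (locally (RtoC 0))); [apply Hdw, in_disk_0|].
  apply (ex_Cderive_continuous (F t) 0). apply (semigroup_holomorphic F HF); [assumption|apply in_disk_0]. }
assert (H2 : filterlim (fun s => F t (F s 0)) (Rbar_locally p_infty) (locally (RtoC 0))).
{ apply (filterlim_ext_loc (fun s => F (s + t) 0)).
  - exists 0. intros s Hs. rewrite Rplus_comm. apply (semigroup_add F HF); [lra|lra|apply in_disk_0].
  - apply (filterlim_comp _ _ _ (fun s => s + t) (fun s => F s 0) _ (Rbar_locally p_infty));
      [|apply Hdw, in_disk_0].
    intros P [M HM]. exists (M - t). intros s Hs. apply HM; lra. }
exact (filterlim_locally_unique (V := C_NormedModule) _ _ _ H1 H2).
Qed.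

Lemma generator_0 (F : R -> C -> C) (f : C -> C) :
  is_generator F f -> (forall t, 0 <= t -> F t 0 = 0) -> f 0 = 0.
Proof.
intros [_ Hf] H0.
refine (filterlim_locally_unique (V := C_NormedModule) _ _ _ (Hf 0 in_disk_0) _).
apply (filterlim_ext_loc (fun _ => RtoC 0)); [|apply filterlim_const].
exists (mkposreal 1 Rlt_0_1). intros t _ Ht. rewrite H0 by lra. Ceq. unfold Cdiv; ring.
Qed.

(** By Schwarz's lemma [Re (conj z (z - F t z)) >= |z|^2 - |z| |F t z| >= 0]; dividing by [t] and
    letting [t -> 0] gives the claim. *)
Lemma generator_Re_ge_0 (F : R -> C -> C) (f : C -> C) :
  is_semigroup F -> is_generator F f -> (forall t, 0 <= t -> F t 0 = 0) ->
  forall z, in_disk z -> 0 <= Re (Cconj z * f z).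
Proof.
intros HF [_ Hf] H0 z Hz.
assert (Hl : filterlim (fun t => Re (Cconj z * ((z - F t z) / RtoC t)))
  (at_right 0) (locally (Re (Cconj z * f z)))).
{ apply (filterlim_comp _ _ _ (fun t => ((z - F t z) / RtoC t)%C)
    (fun w => Re (Cconj z * w)) _ (locally (f z))); [apply Hf, Hz|].
  apply (continuous_Re (fun w : C => Cconj z * w)%C (f z)).
  apply (continuous_Cmult (fun _ => Cconj z) (fun w => w)); [apply continuous_const|apply continuous_id]. }
apply (filterlim_le (F := at_right 0) (fun _ => 0)
  (fun t => Re (Cconj z * ((z - F t z) / RtoC t))) 0 (Re (Cconj z * f z)));
  [|apply filterlim_const|exact Hl].
exists (mkposreal 1 Rlt_0_1). intros t _ Ht.
replace (Cconj z * ((z - F t z) / RtoC t))%C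
  with (RtoC (/ t) * (Cconj z * z - Cconj z * F t z))%C.
- rewrite re_scal_l, Cconj_mult_self. apply Rmult_le_pos; [left; apply Rinv_0_lt_compat, Ht|].
  unfold Cminus. rewrite re_plus, re_opp, re_RtoC.
  assert (Hs : Cmod (F t z) <= Cmod z).
  { apply (schwarz_lemma (F t)); try assumption.
    - apply (semigroup_holomorphic F HF); lra.
    - intros w Hw; apply (semigroup_self_map F HF); [lra|assumption].
    - apply H0; lra. }
  assert (Hr := re_le_Cmod (Cconj z * F t z)). rewrite Cmod_mult, Cmod_conj in Hr.
  apply Rabs_le_between in Hr. generalize (Cmod_ge_0 z); nra.
- rewrite RtoC_inv by lra. unfold Cdiv; ring.
Qed.

(** The right derivative of an orbit at time [t] is [- f (F t z)]. If [f] vanished, the orbit of 1/2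
    would be constant and could not tend to 0. *)
Lemma generator_not_zero (F : R -> C -> C) (f : C -> C) :
  is_semigroup F -> is_generator F f -> is_denjoy_wolff_point F 0 ->
  ~ (forall z, in_disk z -> f z = 0).
Proof.
intros HF [_ Hf] [_ Hdw] Hz.
assert (Hh : in_disk (RtoC (1 / 2))) by (unfold in_disk; rewrite Cmod_R, Rabs_pos_eq; lra).
assert (HT : forall T, 0 <= T -> F T (RtoC (1 / 2)) = RtoC (1 / 2)).
{ intros T HT. rewrite <- (semigroup_0 F HF _ Hh) at 2.
  apply (right_derivative_0_const (fun t => F t (RtoC (1 / 2)))); [| |assumption].
  - intros t0 Ht0. apply (semigroup_continuous F HF); assumption.
  - intros t eps Ht.
    assert (Hd : in_disk (F t (RtoC (1 / 2)))) by (apply (semigroup_self_map F HF); assumption).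
    pose proof (Hf _ Hd) as Hl. rewrite (Hz _ Hd) in Hl.
    assert (Hn : locally (RtoC 0) (fun w => Cmod w < eps)).
    { apply locally_disk. rewrite Cmod_0. apply cond_pos. }
    destruct (Hl _ Hn) as [d Hd'].
    exists d; split; [apply cond_pos|]. intros s Hs.
    specialize (Hd' s). rewrite Rplus_comm, (semigroup_add F HF) by (assumption || lra).
    set (w := F t (RtoC (1 / 2))) in *.
    assert (Hb : Cmod ((w - F s w) / RtoC s) < eps).
    { apply Hd'; [|lra]. change (Rabs (s - 0) < d). rewrite Rabs_pos_eq; lra. }
    rewrite Cmod_div, Cmod_R, Rabs_pos_eq in Hb by (try lra; intros E; apply RtoC_inj in E; lra).
    apply Rlt_div_l in Hb; [|lra].
    replace (F s w - w)%C with (- (w - F s w))%C by ring. rewrite Cmod_opp. lra. }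
assert (E : RtoC 0 = RtoC (1 / 2)).
{ refine (filterlim_locally_unique (V := C_NormedModule) _ _ _ (Hdw _ Hh) _).
  apply (filterlim_ext_loc (fun _ => RtoC (1 / 2))); [|apply filterlim_const].
  exists 0. intros t Ht. symmetry; apply HT; lra. }
apply RtoC_inj in E. lra.
Qed.

(* The Berkson-Porta representation of the generator. *)
Lemma generator_factor (F : R -> C -> C) (f : C -> C) :
  is_semigroup F -> is_generator F f -> is_denjoy_wolff_point F 0 ->
  exists p : C -> C, holomorphic_on_disk p /\
    (forall z, in_disk z -> f z = (z * p z)%C) /\
    (forall z, in_disk z -> 0 <= Re (p z) /\ p z <> 0) /\
    C_derive f 0 = p 0.
Proof.
intros HF HG HD.
pose proof (semigroup_fixes_0 F HF HD) as HF0.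
pose proof (generator_0 F f HG HF0) as Hf0.
pose proof (generator_Re_ge_0 F f HF HG HF0) as Hre.
pose proof (proj1 HG) as Hf.
destruct (Hf 0 in_disk_0) as [l Hl].
pose (p := fun z : C => if Ceq_dec z 0 then (l : C) else (f z / z)%C).
assert (Hp0 : p 0 = l) by (unfold p; destruct (Ceq_dec 0 0); congruence).
assert (Hloc : forall z : C, z <> 0 -> locally z (fun w => (f w / w)%C = p w)).
{ intros z Hz. generalize (locally_neq z 0 Hz); apply filter_imp; intros w Hw.
  unfold p; destruct (Ceq_dec w 0); [contradiction|reflexivity]. }
assert (Hdn : forall z : C, in_disk z -> z <> 0 -> ex_Cderive p z).
{ intros z Hz Hn. apply (ex_Cderive_ext_loc (fun w => (f w / w)%C)); [auto|].
  assert (Hfz := Hf z Hz). Cderiv. assumption. }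
(* Away from 0 the quotient [f w / w] is the slope function of [f] at 0, since [f 0 = 0]. *)
assert (Hc0 : continuous p (RtoC 0)).
{ apply is_Cderive_slope in Hl. destruct Hl as (phi & Cphi & Ephi & Hphi).
  apply (continuous_ext_loc _ phi); [|assumption].
  generalize Hphi; apply filter_imp; intros w Hw. Ceq. unfold p.
  destruct (Ceq_dec w 0) as [->|Hn]; [assumption|].
  rewrite Hw, Hf0. field. assumption. }
assert (Hfac : forall z, in_disk z -> f z = (z * p z)%C).
{ intros z Hz; unfold p. destruct (Ceq_dec z 0) as [->|Hn]; [rewrite Hf0; ring|field; assumption]. }
assert (Hhol : holomorphic_on_disk p).
{ intros z Hz. destruct (Ceq_dec z 0) as [->|Hn]; [|auto].
  apply (removable_singularity p 1); [lra| |].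
  - intros w Hw. destruct (Ceq_dec w 0) as [->|Hn]; [assumption|].
    apply ex_Cderive_continuous; auto.
  - intros w Hw. apply Hdn; [apply Hw|]. apply Cneq0_Cmod, Hw. }
assert (Hpos : forall z : C, in_disk z -> z <> 0 -> 0 <= Re (p z)).
{ intros z Hz Hn. specialize (Hre z Hz).
  rewrite Hfac, Cmult_assoc, Cconj_mult_self, re_scal_l in Hre by assumption.
  assert (0 < Cmod z ^ 2) by (apply pow_lt, Cmod_gt_0, Hn). nra. }
assert (Hpos' : forall z, in_disk z -> 0 <= Re (p z)).
{ intros z Hz. destruct (Ceq_dec z 0) as [->|Hn]; [|auto].
  (* The sign at 0 is a limit along the negative real axis. *)
  apply (continuous_left_nonneg (fun s : R => Re (p (RtoC s))) (-1)); [lra| |].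
  - apply continuous_Re, (continuous_comp RtoC p); [apply continuous_RtoC|assumption].
  - intros s Hs. apply Hpos.
    + unfold in_disk. rewrite Cmod_R. apply Rabs_def1; lra.
    + intros E; apply RtoC_inj in E; lra. }
exists p. split; [assumption|split; [assumption|split]].
(* If [p z = 0], the Schwarz-Pick inequality between an arbitrary [w] and [z] has right-hand side 0,
   so [p w = 0] and [f] would vanish identically. *)
- intros z Hz. split; [auto|]. intros E.
  apply (generator_not_zero F f HF HG HD). intros w Hw. rewrite Hfac by assumption.
  replace (p w) with (RtoC 0); [ring|].
  pose proof (schwarz_pick p w z Hhol Hpos' Hw Hz) as H.
  rewrite E in H.
  rewrite Cconj_RtoC in H.
  rewrite Cplus_0_r, re_RtoC, !Rmult_0_r in H.
  symmetry. apply Cmod_eq_0.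
  unfold in_disk in *. pose proof (Cmod_ge_0 w); pose proof (Cmod_ge_0 z).
  assert (0 < (1 - Cmod w ^ 2) * (1 - Cmod z ^ 2)) by (apply Rmult_lt_0_compat; nra).
  pose proof (pow2_ge_0 (Cmod (p w))).
  assert (Cmod (p w) ^ 2 = 0) by nra.
  generalize (Cmod_ge_0 (p w)); nra.
- rewrite Hp0. apply is_C_derive_unique, Hl.
Qed.

(** * Boundary poles of functions with nonnegative real part *)

(* [(1 - r) * q (r * zeta) -> al] as [r -> 1-], with the function of [r] extended
   to a neighbourhood of 1. *)
Definition radial_residue (q : C -> C) (zeta al : C) : Prop :=
  exists V : R -> C, continuous V 1 /\ V 1 = al /\
    forall r, 0 < r < 1 -> V r = (RtoC (1 - r) * q (RtoC r * zeta))%C.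

Lemma in_disk_radius (r : R) (zeta : C) :
  Cmod zeta = 1 -> 0 < r < 1 -> in_disk (RtoC r * zeta).
Proof. intros Hz Hr. unfold in_disk. rewrite Cmod_mult, Hz, Cmod_R, Rabs_pos_eq; lra. Qed.

Lemma Cconj_mult_unit (zeta : C) : Cmod zeta = 1 -> (Cconj zeta * zeta)%C = 1.
Proof. intros H. rewrite Cconj_mult_self, H. f_equal; ring. Qed.

Lemma Cmod_unit_sub (zeta z : C) : Cmod zeta = 1 -> Cmod (1 - Cconj zeta * z) = Cmod (zeta - z).
Proof.
intros H. replace (1 - Cconj zeta * z)%C with (Cconj zeta * (zeta - z))%C.
- rewrite Cmod_mult, Cmod_conj, H. ring.
- rewrite <- (Cconj_mult_unit zeta H). ring.
Qed.

(** The Schwarz-Pick inequality between [z] and [r zeta], multiplied by [1 - r]: together with the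
    factor [1 - r] of [1 - r^2] this makes up the square needed to turn [q (r zeta)] into the
    residue on the left, while one factor suffices on the right. Then [r -> 1]. *)
Lemma julia_schwarz_pick (q : C -> C) (zeta al z : C) :
  holomorphic_on_disk q -> (forall z, in_disk z -> 0 <= Re (q z)) ->
  Cmod zeta = 1 -> radial_residue q zeta al -> in_disk z ->
  Cmod al ^ 2 * (1 - Cmod z ^ 2) <= 2 * Cmod (zeta - z) ^ 2 * (Re (q z) * Re al).
Proof.
intros Hq Hp Hzeta (V & CV & <- & HV) Hz.
rewrite <- (Cmod_unit_sub zeta z) by assumption.
pose (G := fun r : R =>
  4 * Cmod (1 - RtoC r * Cconj zeta * z) ^ 2 * (Re (q z) * Re (V r))
  - Cmod (RtoC (1 - r) * q z + Cconj (V r)) ^ 2 * ((1 - Cmod z ^ 2) * (1 + r))).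
assert (HG : 0 <= G 1).
{ apply (continuous_left_nonneg G 0); [lra| |].
  - assert (CR := continuous_RtoC 1).
    assert (CR1 := continuous_RtoC_1_minus 1).
    assert (Hsq : forall (h : R -> R) x, continuous h x -> continuous (fun r => h r ^ 2) x).
    { intros h x Hh. simpl. apply (continuous_mult (K := R_AbsRing)); [assumption|].
      apply (continuous_mult (K := R_AbsRing)); [assumption|apply continuous_const]. }
    unfold G. apply (continuous_minus (V := R_NormedModule)).
    + apply (continuous_mult (K := R_AbsRing)).
      * apply (continuous_mult (K := R_AbsRing)); [apply continuous_const|].
        apply (Hsq (fun r : R => Cmod (1 - RtoC r * Cconj zeta * z))), continuous_Cmod. Ccont.
      * apply (continuous_mult (K := R_AbsRing)); [apply continuous_const|].
        apply continuous_Re; assumption.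
    + apply (continuous_mult (K := R_AbsRing)).
      * apply (Hsq (fun r : R => Cmod (RtoC (1 - r) * q z + Cconj (V r)))), continuous_Cmod.
        apply (continuous_Cplus (fun r => RtoC (1 - r) * q z)%C (fun r => Cconj (V r))).
        -- apply (continuous_Cmult (fun r => RtoC (1 - r)) (fun _ => q z)); [assumption|].
           apply continuous_const.
        -- apply continuous_Cconj; assumption.
      * apply (continuous_mult (K := R_AbsRing)); [apply continuous_const|].
        apply (continuous_plus (V := R_NormedModule)); [apply continuous_const|apply continuous_id].
  - intros r Hr. unfold G.
    pose proof (schwarz_pick q z (RtoC r * zeta) Hq Hp Hz (in_disk_radius r zeta Hzeta Hr)) as H.
    rewrite (HV r Hr), Cmult_conj, re_scal_l.
    rewrite Cmult_conj, Cmod_mult, Hzeta, Cmod_R, Rabs_pos_eq in H by lra.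
    rewrite Cconj_RtoC in H.
    rewrite Cconj_RtoC.
    rewrite <- Cmult_plus_distr_l, Cmod_mult, Cmod_R, Rabs_pos_eq by lra.
    apply Rmult_le_compat_l with (r := 1 - r) in H; [|lra]. nra. }
unfold G in HG.
replace (RtoC (1 - 1)) with (RtoC 0) in HG by (f_equal; ring).
rewrite Cmult_0_l, Cplus_0_l, Cmod_conj, Cmult_1_l in HG. lra.
Qed.

Lemma julia (q : C -> C) (zeta al : C) :
  holomorphic_on_disk q -> (forall z, in_disk z -> 0 <= Re (q z)) ->
  Cmod zeta = 1 -> radial_residue q zeta al -> al <> 0 ->
  al = RtoC (Cmod al) /\
  forall z, in_disk z ->
    Cmod al / 2 * ((1 - Cmod z ^ 2) / Cmod (zeta - z) ^ 2) <= Re (q z).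
Proof.
intros Hq Hp Hzeta Hres Hal.
pose proof (julia_schwarz_pick q zeta al) as HJ.
assert (Hal0 : 0 < Cmod al) by (apply Cmod_gt_0; assumption).
assert (HJ' : forall z, in_disk z -> Cmod al ^ 2 * (1 - Cmod z ^ 2) <=
  2 * Cmod (zeta - z) ^ 2 * (Re (q z) * Re al)) by auto. clear HJ.
assert (Hre : 0 <= Re al).
{ destruct Hres as (V & CV & <- & HV).
  apply (continuous_left_nonneg (fun r => Re (V r)) 0); [lra|apply continuous_Re; assumption|].
  intros r Hr. rewrite HV, re_scal_l by assumption.
  apply Rmult_le_pos; [lra|apply Hp, in_disk_radius; assumption]. }
(* The inequality is applied at [z = r zeta] itself. Multiplied by [1 - r], its right-hand side
   again contains the residue, and the limit [r -> 1] leaves no room for an imaginary part. *)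
assert (Hsq : Cmod al ^ 2 <= Re al ^ 2).
{ destruct Hres as (V & CV & HV1 & HV).
  pose (G := fun r => 2 * (Re (V r) * Re al) - Cmod al ^ 2 * (1 + r)).
  assert (HG : 0 <= G 1).
  { apply (continuous_left_nonneg G 0); [lra| |].
    - unfold G. apply (continuous_minus (V := R_NormedModule)).
      + apply (continuous_mult (K := R_AbsRing)); [apply continuous_const|].
        apply (continuous_mult (K := R_AbsRing)); [|apply continuous_const].
        apply continuous_Re; assumption.
      + apply (continuous_mult (K := R_AbsRing)); [apply continuous_const|].
        apply (continuous_plus (V := R_NormedModule)); [apply continuous_const|apply continuous_id].
    - intros r Hr. unfold G. rewrite HV, re_scal_l by assumption.
      specialize (HJ' _ (in_disk_radius r zeta Hzeta Hr)).
      replace (zeta - RtoC r * zeta)%C with (RtoC (1 - r) * zeta)%C in HJ'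
        by (rewrite RtoC_minus; ring).
      rewrite !Cmod_mult, Hzeta, !Cmod_R, !Rabs_pos_eq in HJ' by lra.
      apply Rmult_le_reg_l with (1 - r); [lra|]. nra. }
  unfold G in HG; rewrite HV1 in HG. nra. }
assert (Him : Im al = 0) by (rewrite Cmod2_alt in Hsq; nra).
assert (Hmod : Cmod al = Re al).
{ apply Rsqr_inj; [lra|assumption|]. rewrite !Rsqr_pow2, Cmod2_alt, Him. ring. }
split.
- rewrite Hmod. destruct al as [x y]; simpl in *. unfold RtoC; f_equal; assumption.
- intros z Hz. specialize (HJ' z Hz). rewrite Hmod in *.
  assert (Hm : 0 < Cmod (zeta - z)).
  { apply Cmod_gt_0, Cneq_Cmod. rewrite Hzeta; exact Hz. }
  assert (Hn : 0 < Cmod (zeta - z) ^ 2) by (apply pow_lt; assumption).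
  replace (Re al / 2 * ((1 - Cmod z ^ 2) / Cmod (zeta - z) ^ 2))
    with (Re al * (1 - Cmod z ^ 2) / 2 / Cmod (zeta - z) ^ 2) by (field; lra).
  apply Rle_div_l; [assumption|].
  apply Rmult_le_reg_l with (Re al); [assumption|]. nra.
Qed.

(** The Schwarz kernel, whose real part for [|zeta| = 1] is the Poisson kernel. *)
Definition herglotz (zeta z : C) : C := ((zeta + z) / (zeta - z))%C.

Lemma Cneq_unit_disk (zeta z : C) : Cmod zeta = 1 -> in_disk z -> (zeta - z)%C <> 0.
Proof. intros H Hz. apply Cneq_Cmod. rewrite H; exact Hz. Qed.

(** The kernel with pole at [xi] stays bounded along the radius to [zeta], so the factor [1 - r]
    removes it in the limit. *)
Lemma radial_residue_sub (q : C -> C) (zeta xi al c : C) :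
  Cmod zeta = 1 -> Cmod xi = 1 -> xi <> zeta -> radial_residue q zeta al ->
  radial_residue (fun z => (q z - c * herglotz xi z)%C) zeta al.
Proof.
intros Hz Hx Hn (V & CV & HV1 & HV).
exists (fun r => (V r - RtoC (1 - r) * (c * herglotz xi (RtoC r * zeta)))%C).
split; [|split].
- apply (continuous_Cminus V); [assumption|].
  assert (CR := continuous_RtoC 1).
  assert (CR1 := continuous_RtoC_1_minus 1).
  apply (continuous_Cmult (fun r => RtoC (1 - r))); [assumption|].
  unfold herglotz. Ccont. rewrite Cmult_1_l. intros E; apply Hn, Ceq_minus, E.
- rewrite HV1. replace (RtoC (1 - 1)) with (RtoC 0) by (f_equal; ring). Ceq. ring.
- intros r Hr. rewrite HV by assumption. Ceq. ring.
Qed.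

Lemma radial_residue_ext (q1 q2 : C -> C) (zeta al : C) :
  (forall z, q1 z = q2 z) -> radial_residue q1 zeta al -> radial_residue q2 zeta al.
Proof.
intros E (V & CV & HV1 & HV). exists V; split; [assumption|split; [assumption|]].
intros r Hr. rewrite <- E; auto.
Qed.

(** The invariant after [k] subtractions also records that the poles still to be treated have kept
    their residues, which is what lets Julia's lemma be applied again. The alternative [al n = 0]
    accommodates a vanishing [df n]. *)
Lemma subtract_poles (q : C -> C) (N : nat) (zeta : nat -> C) (al : nat -> R) :
  holomorphic_on_disk q -> (forall z, in_disk z -> 0 <= Re (q z)) ->
  (forall n m, (1 <= n <= N)%nat -> (1 <= m <= N)%nat -> n <> m -> zeta n <> zeta m) ->
  (forall n, (1 <= n <= N)%nat -> Cmod (zeta n) = 1) ->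
  (forall n, (1 <= n <= N)%nat -> al n = 0 \/ 0 < al n /\ radial_residue q (zeta n) (al n)) ->
  let h z := (q z - sum_n_m (fun n => RtoC (al n / 2) * herglotz (zeta n) z) 1 N)%C in
  holomorphic_on_disk h /\ forall z, in_disk z -> 0 <= Re (h z).
Proof.
intros Hq Hp Hdis Hun Hal h.
pose (h' := fun k z => (q z - sum_n_m (fun n => RtoC (al n / 2) * herglotz (zeta n) z) 1 k)%C).
assert (HS : forall k z, h' (S k) z = (h' k z - RtoC (al (S k) / 2) * herglotz (zeta (S k)) z)%C).
{ intros k z. unfold h'. rewrite sum_n_Sm by lia. unfold plus; simpl. ring. }
assert (H : forall k, (k <= N)%nat -> holomorphic_on_disk (h' k) /\
  (forall z, in_disk z -> 0 <= Re (h' k z)) /\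
  (forall n, (k < n <= N)%nat -> al n = 0 \/ 0 < al n /\ radial_residue (h' k) (zeta n) (al n))).
{ induction k as [|k IH]; intros Hk.
  - assert (E : forall z, q z = h' O z).
    { intros z. unfold h'. rewrite sum_n_m_zero by lia. unfold zero; simpl; ring. }
    split; [|split].
    + intros z Hz. apply (ex_Cderive_ext_loc q); [|apply Hq, Hz]. apply filter_forall, E.
    + intros z Hz. rewrite <- E; auto.
    + intros n Hn. destruct (Hal n ltac:(lia)) as [H|[H1 H2]]; [left; assumption|right].
      split; [assumption|]. apply (radial_residue_ext q); auto.
  - destruct (IH ltac:(lia)) as (I1 & I2 & I3).
    assert (HzS : Cmod (zeta (S k)) = 1) by (apply Hun; lia).
    split; [|split].
    + intros z Hz.
      apply (ex_Cderive_ext_loc (fun z => h' k z - RtoC (al (S k) / 2) * herglotz (zeta (S k)) z)%C).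
      * apply filter_forall; intros w; symmetry; apply HS.
      * assert (Hh := I1 z Hz). unfold herglotz. Cderiv.
        apply Cneq_unit_disk; assumption.
    + intros z Hz. rewrite HS.
      destruct (I3 (S k) ltac:(lia)) as [E|[H1 H2]].
      * rewrite E. replace (RtoC (0 / 2)) with (RtoC 0) by (f_equal; field).
        replace (h' k z - 0 * herglotz (zeta (S k)) z)%C with (h' k z) by ring. auto.
      * unfold Cminus. rewrite re_plus, re_opp, re_scal_l.
        unfold herglotz. rewrite Re_cayley by (apply Cneq_unit_disk; assumption).
        destruct (julia (h' k) (zeta (S k)) (al (S k)) I1 I2 HzS H2) as [_ HJ].
        { intros E; apply RtoC_inj in E; lra. }
        specialize (HJ z Hz). rewrite Cmod_R, Rabs_pos_eq in HJ by lra.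
        rewrite HzS, pow1. lra.
    + intros n Hn. destruct (I3 n ltac:(lia)) as [H|[H1 H2]]; [left; assumption|right].
      split; [assumption|].
      apply (radial_residue_ext (fun z => h' k z - RtoC (al (S k) / 2) * herglotz (zeta (S k)) z)%C).
      * intros z; symmetry; apply HS.
      * apply radial_residue_sub; auto; [apply Hun; lia|]. apply Hdis; lia. }
destruct (H N (le_n N)) as (H1 & H2 & _). split; assumption.
Qed.

(** Write [G = h z - i Im (h 0)], [x = |G|], [K = Re (h 0)], [r = |z|]. The Schwarz-Pick inequality
    between [z] and 0 is [|G + K|^2 (1 - r^2) <= 4 K Re G], and [Re G <= x] turns it into a
    quadratic inequality in [x] whose roots are the two bounds. *)
Lemma half_plane_growth (h : C -> C) :
  holomorphic_on_disk h -> (forall z, in_disk z -> 0 <= Re (h z)) ->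
  forall z, in_disk z ->
    Re (h 0) * ((1 - Cmod z) / (1 + Cmod z))
      <= Cmod (h z - Ci * RtoC (Im (h 0)))
      <= Re (h 0) * ((1 + Cmod z) / (1 - Cmod z)).
Proof.
intros Hh Hp z Hz.
pose proof (schwarz_pick h z 0 Hh Hp Hz in_disk_0) as H.
set (G := (h z - Ci * RtoC (Im (h 0)))%C).
assert (E : (h z + Cconj (h 0))%C = (G + RtoC (Re (h 0)))%C).
{ unfold G. destruct (h z) as [x y], (h 0) as [a b].
  unfold Cconj, Ci, RtoC, Re, Im, Cminus, Cplus, Cmult, Copp; simpl. f_equal; ring. }
assert (EG : Re (h z) = Re G).
{ unfold G. destruct (h z) as [x y]. unfold Ci, RtoC, Re, Cminus, Cplus, Cmult, Copp; simpl. ring. }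
replace (1 - Cconj 0 * z)%C with (RtoC 1) in H
  by (rewrite Cconj_RtoC; ring).
rewrite E, EG, Cmod_1, Cmod_0, Cmod2_alt, re_plus, im_plus, re_RtoC, im_RtoC, Rplus_0_r in H.
pose proof (Hp 0 in_disk_0) as HK. set (K := Re (h 0)) in *.
pose proof (Cmod2_alt G) as HG. pose proof (re_le_Cmod G) as Hr.
apply Rabs_le_between in Hr. pose proof (Cmod_ge_0 G) as HG0.
set (x := Cmod G) in *. pose proof (Cmod_ge_0 z) as Hz0. unfold in_disk in Hz.
set (r := Cmod z) in *.
assert (H1 : (x ^ 2 + K ^ 2) * (1 - r ^ 2) <= 2 * (K * x) * (1 + r ^ 2)).
{ assert (K * Re G <= K * x) by (apply Rmult_le_compat_l; lra).
  apply Rle_trans with (2 * (K * Re G) * (1 + r ^ 2)).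
  - rewrite HG. nra.
  - apply Rmult_le_compat_r; nra. }
(* This is [H1] factored. The second factor exceeds the first by [2 r (x + K) >= 0], so the first is
   nonpositive and the second nonnegative. *)
assert (H2 : (x * (1 - r) - K * (1 + r)) * (x * (1 + r) - K * (1 - r)) <= 0) by nra.
assert (H3 : x * (1 - r) - K * (1 + r) <= x * (1 + r) - K * (1 - r)) by nra.
assert (H4 : x * (1 - r) - K * (1 + r) <= 0) by nra.
assert (H5 : 0 <= x * (1 + r) - K * (1 - r)) by nra.
split.
- replace (K * ((1 - r) / (1 + r))) with (K * (1 - r) / (1 + r)) by (field; lra).
  apply Rle_div_l; lra.
- replace (K * ((1 + r) / (1 - r))) with (K * (1 + r) / (1 - r)) by (field; lra).
  apply Rle_div_r; lra.
Qed.

(** Since [1/p = z/f], at [z = r zeta] the product of [1 - r] and [1/p] is [- r] divided by the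
    difference quotient [f z / (z - zeta)]. *)
Lemma radial_residue_of_angular (f p : C -> C) (zeta l : C) :
  (forall z, in_disk z -> f z = (z * p z)%C) -> (forall z, in_disk z -> p z <> 0) ->
  Cmod zeta = 1 -> is_angular_derivative f zeta l -> l <> 0 ->
  radial_residue (fun z => (/ p z)%C) zeta (- / l).
Proof.
intros Hf Hp Hz Hl Hn.
pose (U := fun r => if Rlt_dec r 1 then (f (RtoC r * zeta) / (RtoC r * zeta - zeta))%C else l).
assert (U1 : U 1 = l) by (unfold U; destruct (Rlt_dec 1 1); [lra|reflexivity]).
assert (CU : continuous U 1).
{ intros P HP. rewrite U1 in HP.
  (* The radius lies in the Stolz region of constant 2, because
     [|r zeta - zeta| = 1 - r < 2 (1 - r)]. *)
  destruct (Hl P HP 2 ltac:(lra)) as [d Hd].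
  exists (mkposreal _ (Rmin_pos _ _ (cond_pos d) Rlt_0_1)). intros r Hr.
  change (Rabs (r - 1) < Rmin d 1) in Hr.
  pose proof (Rmin_l d 1); pose proof (Rmin_r d 1). apply Rabs_lt_between in Hr.
  unfold U. destruct (Rlt_dec r 1) as [Hr1|Hr1]; [|apply locally_singleton; assumption].
  assert (Hs : Cmod (RtoC r * zeta - zeta) = 1 - r).
  { replace (RtoC r * zeta - zeta)%C with (RtoC (- (1 - r)) * zeta)%C.
    - rewrite Cmod_mult, Hz, Cmod_R, Rabs_Ropp, Rabs_pos_eq; lra.
    - rewrite RtoC_opp, RtoC_minus; ring. }
  apply Hd.
  - apply C_NormedModule_mixin_compat1.
    change (Cmod (RtoC r * zeta - zeta) < d). lra.
  - split; [apply in_disk_radius; [assumption|lra]|].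
    rewrite Hs, Cmod_mult, Hz, Cmod_R, Rabs_pos_eq; lra. }
exists (fun r => (- RtoC r / U r)%C). split; [|split].
- assert (CR := continuous_RtoC 1). Ccont. rewrite U1; assumption.
- rewrite U1. Ceq. field. assumption.
- intros r Hr. unfold U. destruct (Rlt_dec r 1) as [_|]; [|lra].
  assert (Hd := in_disk_radius r zeta Hz Hr). rewrite Hf by assumption.
  assert (Hpn := Hp _ Hd).
  assert (N1 : zeta <> 0) by (apply Cneq0_Cmod; lra).
  assert (N2 : RtoC r <> 0) by (intros E; apply RtoC_inj in E; lra).
  assert (N3 : (RtoC r * zeta - zeta)%C <> 0).
  { replace (RtoC r * zeta - zeta)%C with (- (zeta - RtoC r * zeta))%C by ring.
    intros E. apply (Cneq_unit_disk zeta (RtoC r * zeta) Hz Hd).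
    rewrite <- (Copp_0). rewrite <- E; ring. }
  rewrite RtoC_minus. Ceq. field. repeat split; auto.
Qed.

Lemma sum_herglotz_0 (N : nat) (zeta : nat -> C) (al : nat -> R) :
  (forall n, (1 <= n <= N)%nat -> Cmod (zeta n) = 1) ->
  sum_n_m (fun n => RtoC (al n / 2) * herglotz (zeta n) 0)%C 1 N
  = RtoC (1 / 2 * sum_n_m al 1 N).
Proof.
induction N as [|N IH]; intros Hz.
- rewrite !sum_n_m_zero by lia. unfold zero; simpl. rewrite Rmult_0_r; reflexivity.
- rewrite !sum_n_Sm by lia. rewrite IH by (intros; apply Hz; lia).
  unfold plus; simpl. replace (herglotz (zeta (S N)) 0) with (RtoC 1).
  + rewrite <- RtoC_mult, <- RtoC_plus. f_equal. field.
  + unfold herglotz. rewrite Cplus_0_r. unfold Cminus. rewrite Copp_0, Cplus_0_r.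
    symmetry; apply Cinv_r, Cneq0_Cmod. rewrite Hz by lia; lra.
Qed.

(** Termwise, [z (1/(2z) - 1/(z - zeta)) = 1/2 + z/(zeta - z)], which is half the kernel. *)
Lemma sum_herglotz (N : nat) (zeta : nat -> C) (al : nat -> R) (z : C) :
  z <> 0 -> (forall n, (1 <= n <= N)%nat -> (zeta n - z)%C <> 0) ->
  sum_n_m (fun n => RtoC (al n / 2) * herglotz (zeta n) z)%C 1 N
  = (z * sum_n_m (fun n => RtoC (al n) * (1 / (2 * z) - 1 / (z - zeta n)))%C 1 N)%C.
Proof.
intros Hz. induction N as [|N IH]; intros Hn.
- rewrite !sum_n_m_zero by lia. unfold zero; simpl. ring.
- rewrite !sum_n_Sm by lia. rewrite IH by (intros; apply Hn; lia).
  unfold plus; simpl. rewrite Cmult_plus_distr_l. f_equal.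
  assert (N1 := Hn (S N) ltac:(lia)).
  assert (N2 : (z - zeta (S N))%C <> 0).
  { intros E; apply N1. replace (zeta (S N) - z)%C with (- (z - zeta (S N)))%C by ring.
    rewrite E; ring. }
  assert (N3 : RtoC 2 <> 0) by (intros E; apply RtoC_inj in E; lra).
  rewrite RtoC_div by lra. unfold herglotz. field. auto.
Qed.

Theorem theorem6p3 (F : R -> C -> C) (f : C -> C)
    (N : nat) (zeta : nat -> C) (df : nat -> C) :
  is_semigroup F ->
  is_generator F f ->
  is_denjoy_wolff_point F 0 ->
  (forall n m, (1 <= n <= N)%nat -> (1 <= m <= N)%nat -> n <> m ->
     zeta n <> zeta m) ->
  (forall n, (1 <= n <= N)%nat -> boundary_regular_null_point f (zeta n)) ->
  (forall n, (1 <= n <= N)%nat -> is_angular_derivative f (zeta n) (df n)) ->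
  let K := Re (/ C_derive f 0)%C - 1 / 2 * sum_n_m (fun n => 1 / Cmod (df n)) 1 N in
  exists h : C -> C,
    is_extension_at_0
      (fun z => (z * (1 / f z
         - sum_n_m (fun n => RtoC (1 / Cmod (df n)) * (1 / (2 * z) - 1 / (z - zeta n)))
             1 N))%C) h /\
    forall z : C, in_disk z ->
      K * ((1 - Cmod z) / (1 + Cmod z))
        <= Cmod (h z - Ci * RtoC (Im (/ C_derive f 0)))%C
        <= K * ((1 + Cmod z) / (1 - Cmod z)).
Proof.
intros HF HG HD Hdis Hbd Hdf K.
destruct (generator_factor F f HF HG HD) as (p & Hp & Hfac & Hpos & Hp0).
unfold K; rewrite Hp0; clear K.
assert (Hun : forall n, (1 <= n <= N)%nat -> Cmod (zeta n) = 1) by (intros n Hn; apply (Hbd n Hn)).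
assert (Hpn : forall z, in_disk z -> p z <> 0) by (intros; apply Hpos; assumption).
pose (q := fun z => (/ p z)%C).
assert (Hq : holomorphic_on_disk q).
{ intros z Hz. apply ex_Cderive_inv; auto. }
assert (Hqpos : forall z, in_disk z -> 0 <= Re (q z)).
{ intros z Hz. unfold q, Cinv, Re; simpl.
  apply Rdiv_le_0_compat; [apply Hpos; assumption|].
  assert (H := pow_lt _ 2 (proj1 (Cmod_gt_0 _) (Hpn z Hz))).
  rewrite Cmod2_alt in H. exact H. }
pose (al := fun n => 1 / Cmod (df n)).
(* Written with the kernels, the function of the theorem is already defined and holomorphic at 0. *)
pose (h := fun z => (q z - sum_n_m (fun n => RtoC (al n / 2) * herglotz (zeta n) z) 1 N)%C).
destruct (subtract_poles q N zeta al Hq Hqpos Hdis Hun) as [Hh Hhpos].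
{ intros n Hn. unfold al. destruct (Ceq_dec (df n) 0) as [E|E].
  - (* This does not occur, and it is harmless since [1 / 0 = 0]. *)
    left. rewrite E, Cmod_0. unfold Rdiv; rewrite Rinv_0; ring.
  - right. assert (Hm : 0 < Cmod (df n)) by (apply Cmod_gt_0; assumption).
    split; [apply Rdiv_lt_0_compat; lra|].
    pose proof (radial_residue_of_angular f p (zeta n) (df n) Hfac Hpn (Hun n Hn) (Hdf n Hn) E) as Hr.
    assert (En : (- / df n)%C <> 0).
    { apply Cneq0_Cmod. rewrite Cmod_opp, Cmod_inv by assumption. apply Rinv_0_lt_compat, Hm. }
    (* Julia's lemma identifies the residue [-1/df n] with its modulus [1/|df n|], the coefficient
       in the theorem. *)
    destruct (julia q (zeta n) _ Hq Hqpos (Hun n Hn) Hr En) as [Hal _].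
    rewrite Cmod_opp, Cmod_inv in Hal by assumption.
    unfold Rdiv; rewrite Rmult_1_l, <- Hal. exact Hr. }
exists h. split; [split; [exact Hh|]|].
- intros z Hz Hz0. unfold h. rewrite sum_herglotz.
  + rewrite Hfac by assumption. unfold q. field_simplify.
    * reflexivity.
    * split; auto.
    * auto.
  + assumption.
  + intros n Hn. apply Cneq_unit_disk; auto.
- intros z Hz.
  (* The subtracted sum is real at 0, so it changes only the real part of [1/f'(0)]. *)
  assert (E : h 0 = (/ p 0 - RtoC (1 / 2 * sum_n_m al 1 N))%C).
  { unfold h. rewrite sum_herglotz_0 by assumption. reflexivity. }
  assert (ER : Re (h 0) = Re (/ p 0) - 1 / 2 * sum_n_m al 1 N)
    by (rewrite E; unfold Cminus; rewrite re_plus, re_opp, re_RtoC; ring).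
  assert (EI : Im (h 0) = Im (/ p 0))
    by (rewrite E; unfold Cminus; rewrite im_plus, im_opp, im_RtoC; ring).
  rewrite <- EI. change (fun n => 1 / Cmod (df n)) with al. rewrite <- ER.
  exact (half_plane_growth h Hh Hhpos z Hz).
Qed.
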